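(* Let $R$ be a commutative coherent ring. Then the category $\mathcal{A}(\mathcal{A}(\mathcal{C}(R)^{\oplus})^{\mathrm{op}})$ is equivalent to the category of finitely presented functors $R\text{-}\mathrm{fpmod}\to\mathbf{Ab}$ on the category of finitely presented $R$-modules, and $\mathcal{A}(\mathcal{A}(\mathcal{C}(R)^{\oplus})^{\mathrm{op}})$ admits an $\mathcal{A}(\mathcal{C}(R)^{\oplus})$-homomorphism structure.
   Context: Composition is written left to right: $\alpha\cdot\beta$ means first $\alpha$, then $\beta$. An Ab-category is a category whose hom-sets are abelian groups with bilinear composition; an additive category is an Ab-category with finite (possibly empty) direct sums. A commutative ring $R$ is coherent if kernels of $R$-module homomorphisms between finitely generated free $R$-modules are finitely generated. $R\text{-}\mathrm{fpmod}$ is the category of finitely presented $R$-modules. $\mathbf{Ab}$ is the category of abelian groups. A finitely presented functor $R\text{-}\mathrm{fpmod}\to\mathbf{Ab}$ is an additive (covariant) functor that is the cokernel of a natural transformation $\mathrm{Hom}(B,-)\to\mathrm{Hom}(A,-)$ between representable functors; morphisms are natural transformations. $\mathcal{C}(R)$ is the Ab-category with one object $\ast$, with endomorphisms the elements of $R$ and composition the ring multiplication. For an Ab-category $\mathbf{A}$, its additive closure $\mathbf{A}^{\oplus}$ has as objects finite (possibly empty) lists $(A_1,\dots,A_m)$ of objects of $\mathbf{A}$; a morphism $(A_1,\dots,A_m)\to(B_1,\dots,B_n)$ is an $m\times n$ matrix of morphisms $\alpha_{ij}:A_i\to B_j$; composition is matrix multiplication. For an additive category $\mathbf{A}$, its Freyd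 category $\mathcal{A}(\mathbf{A})$ has as objects the morphisms $(A\xleftarrow{\rho_A}R_A)$ of $\mathbf{A}$. A morphism from $(A\xleftarrow{\rho_A}R_A)$ to $(B\xleftarrow{\rho_B}R_B)$ is a morphism $\alpha:A\to B$ for which there exists $\rho_\alpha:R_A\to R_B$ with $\rho_A\cdot\alpha=\rho_\alpha\cdot\rho_B$; two such morphisms $\alpha,\alpha'$ are considered equal if there exists $\lambda:A\to R_B$ with $\lambda\cdot\rho_B=\alpha-\alpha'$. Composition and identities are inherited from $\mathbf{A}$. For Ab-categories $\mathbf{A},\mathbf{B}$, a $\mathbf{B}$-homomorphism structure for $\mathbf{A}$ consists of: an object $1\in\mathbf{B}$ (distinguished object); a bilinear functor $H:\mathbf{A}^{\mathrm{op}}\times\mathbf{A}\to\mathbf{B}$ (additive on morphisms in each component); and a bijection $\nu:\mathrm{Hom}_{\mathbf{A}}(A,B)\to\mathrm{Hom}_{\mathbf{B}}(1,H(A,B))$ natural in $A,B\in\mathbf{A}$, i.e. $\nu(\alpha\cdot X\cdot\beta)=\nu(X)\cdot H(\alpha,\beta)$ for all composable triples $\alpha,X,\beta$. *)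

(* Defs.v *)
From Stdlib Require Import Setoid Morphisms.
From HB Require Import structures.
From mathcomp Require Import all_boot all_algebra boolp.

Set Implicit Arguments.
Unset Strict Implicit.
Unset Printing Implicit Defensive.

Import GRing.Theory.
Local Open Scope ring_scope.

Declare Scope cat_scope.
Delimit Scope cat_scope with cat.
Local Open Scope cat_scope.

(** Hom-sets are setoids: [eqv] is the equality of morphisms, so that the morphisms
    of a Freyd category can be identified without forming a quotient type. *)

Record category := Category {
  ob :> Type;
  hom : ob -> ob -> Type;
  eqv : forall A B, hom A B -> hom A B -> Prop;
  idm : forall A, hom A A;
  comp : forall A B C, hom A B -> hom B C -> hom A C;
  eqv_equiv : forall A B, Equivalence (@eqv A B);
  comp_proper : forall A B C,
    Proper (@eqv A B ==> @eqv B C ==> @eqv A C) (@comp A B C);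
  comp_idl : forall A B (f : hom A B), eqv (comp (idm A) f) f;
  comp_idr : forall A B (f : hom A B), eqv (comp f (idm B)) f;
  comp_assoc : forall A B C D (f : hom A B) (g : hom B C) (h : hom C D),
    eqv (comp (comp f g) h) (comp f (comp g h))
}.

Arguments hom {c} A B.
Arguments eqv {c A B} f g.
Arguments idm {c} A.
Arguments comp {c A B C} f g.

Notation "f ≡ g" := (eqv f g) (at level 70, no associativity) : cat_scope.

(** Diagrammatic order: first [f], then [g]. *)
Notation "f ∙ g" := (comp f g) (at level 40, left associativity) : cat_scope.

#[export] Existing Instance eqv_equiv.
#[export] Existing Instance comp_proper.
#[export] Hint Extern 0 (eqv _ _) => reflexivity : core.

Definition op_cat (C : category) : category.
Proof.
refine (@Category C (fun A B => hom B A) (fun A B f g => f ≡ g) (fun A => idm A)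
  (fun A B D f g => g ∙ f) _ _ _ _ _).
- by move=> A B D f f' ef g g' eg; rewrite ef eg.
- by move=> A B f; exact: comp_idr.
- by move=> A B f; exact: comp_idl.
- by move=> A B D E f g h; rewrite comp_assoc.
Defined.

Definition prod_cat (C D : category) : category.
Proof.
refine (@Category (C * D)%type (fun X Y => (hom X.1 Y.1 * hom X.2 Y.2)%type)
  (fun X Y f g => f.1 ≡ g.1 /\ f.2 ≡ g.2) (fun X => (idm X.1, idm X.2))
  (fun X Y Z f g => (f.1 ∙ g.1, f.2 ∙ g.2)) _ _ _ _ _).
- move=> X Y; split=> [f|f g [e1 e2]|f g h [e1 e2] [e3 e4]]; split=> //.
  + by rewrite e1.
  + by rewrite e2.
  + by rewrite e1.
  + by rewrite e2.
- by move=> X Y Z f f' [e1 e2] g g' [e3 e4]; split; rewrite /= ?e1 ?e2 ?e3 ?e4.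
- by move=> X Y f; split; exact: comp_idl.
- by move=> X Y f; split; exact: comp_idr.
- by move=> X Y Z W f g h; split; exact: comp_assoc.
Defined.

Record functor (C D : category) := Functor {
  fob :> C -> D;
  fmap : forall A B : C, hom A B -> hom (fob A) (fob B);
  fmap_proper : forall A B : C, Proper (@eqv C A B ==> eqv) (@fmap A B);
  fmap_id : forall A : C, fmap (idm A) ≡ idm (fob A);
  fmap_comp : forall (A B E : C) (f : hom A B) (g : hom B E),
    fmap (f ∙ g) ≡ fmap f ∙ fmap g
}.

Arguments fmap {C D} F {A B} f : rename.

#[export] Existing Instance fmap_proper.

Definition functor_id (C : category) : functor C C.
Proof.
by exists (fun A => A) (fun A B f => f) => // A B f g e.
Defined.

Definition functor_comp (C D E : category) (F : functor C D) (G : functor D E) :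
  functor C E.
Proof.
exists (fun A => G (F A)) (fun A B f => fmap G (fmap F f)).
- by move=> A B f g e; rewrite e.
- by move=> A; rewrite !fmap_id.
- by move=> A B K f g; rewrite !fmap_comp.
Defined.

Record natural (C D : category) (F G : functor C D) := Natural {
  nt :> forall A : C, hom (F A) (G A);
  ntE : forall (A B : C) (f : hom A B), fmap F f ∙ nt B ≡ nt A ∙ fmap G f
}.

Definition natural_id (C D : category) (F : functor C D) : natural F F.
Proof.
exists (fun A => idm (F A)).
by move=> A B f; rewrite comp_idl comp_idr.
Defined.

Definition natural_comp (C D : category) (F G K : functor C D)
  (s : natural F G) (t : natural G K) : natural F K.
Proof.
exists (fun A => s A ∙ t A).
by move=> A B f; rewrite -comp_assoc ntE !comp_assoc ntE.
Defined.

Definition functor_cat (C D : category) : category.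
Proof.
refine (@Category (functor C D) (@natural C D)
  (fun F G s t => forall A, s A ≡ t A) (@natural_id C D) (@natural_comp C D)
  _ _ _ _ _).
- move=> F G; split=> [s A|s t e A|s t u e e' A] //.
  + by rewrite e.
  + by rewrite e.
- by move=> F G K s s' e t t' e' A /=; rewrite e e'.
- by move=> F G s A; exact: comp_idl.
- by move=> F G s A; exact: comp_idr.
- by move=> F G K L s t u A; exact: comp_assoc.
Defined.

Definition isomorphic (C : category) (X Y : C) : Prop :=
  exists (f : hom X Y) (g : hom Y X), f ∙ g ≡ idm X /\ g ∙ f ≡ idm Y.

Definition equivalent (C D : category) : Prop :=
  exists (F : functor C D) (G : functor D C),
    @isomorphic (functor_cat C C) (functor_comp F G) (functor_id C) /\
    @isomorphic (functor_cat D D) (functor_comp G F) (functor_id D).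

Record ab_category := AbCategory {
  cat :> category;
  hzero : forall A B : cat, hom A B;
  hopp : forall A B : cat, hom A B -> hom A B;
  hadd : forall A B : cat, hom A B -> hom A B -> hom A B;
  hopp_proper : forall A B, Proper (eqv ==> eqv) (@hopp A B);
  hadd_proper : forall A B, Proper (eqv ==> eqv ==> eqv) (@hadd A B);
  hadd_assoc : forall (A B : cat) (f g h : hom A B),
    hadd f (hadd g h) ≡ hadd (hadd f g) h;
  hadd_comm : forall (A B : cat) (f g : hom A B), hadd f g ≡ hadd g f;
  hadd_zerol : forall (A B : cat) (f : hom A B), hadd (hzero A B) f ≡ f;
  hadd_oppl : forall (A B : cat) (f : hom A B), hadd (hopp f) f ≡ hzero A B;
  comp_addl : forall (A B C : cat) (f g : hom A B) (h : hom B C),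
    hadd f g ∙ h ≡ hadd (f ∙ h) (g ∙ h);
  comp_addr : forall (A B C : cat) (f : hom A B) (g h : hom B C),
    f ∙ hadd g h ≡ hadd (f ∙ g) (f ∙ h)
}.

Arguments hzero {a} A B.
Arguments hopp {a A B} f.
Arguments hadd {a A B} f g.

Notation "f ⊞ g" := (hadd f g) (at level 50, left associativity) : cat_scope.
Notation "f ⊟ g" := (hadd f (hopp g)) (at level 50, left associativity) : cat_scope.

#[export] Existing Instance hopp_proper.
#[export] Existing Instance hadd_proper.

Section AbTheory.
Context {C : ab_category}.
Implicit Types A B D : C.

Lemma hadd_zeror A B (f : hom A B) : f ⊞ hzero A B ≡ f.
Proof. by rewrite hadd_comm hadd_zerol. Qed.

Lemma hadd_oppr A B (f : hom A B) : f ⊟ f ≡ hzero A B.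
Proof. by rewrite hadd_comm hadd_oppl. Qed.

Lemma hadd_cancel A B (f g h : hom A B) : f ⊞ g ≡ f ⊞ h -> g ≡ h.
Proof.
move=> e; rewrite -(hadd_zerol g) -(hadd_zerol h) -(hadd_oppl f) -!hadd_assoc.
by rewrite e.
Qed.

Lemma hadd_acac A B (f g h k : hom A B) : (f ⊞ g) ⊞ (h ⊞ k) ≡ (f ⊞ h) ⊞ (g ⊞ k).
Proof.
by rewrite -!hadd_assoc (hadd_assoc g) (hadd_comm g h) -hadd_assoc.
Qed.

Lemma comp_zerol A B D (g : hom B D) : hzero A B ∙ g ≡ hzero A D.
Proof.
apply: (@hadd_cancel _ _ (hzero A B ∙ g)).
by rewrite -comp_addl hadd_zerol hadd_zeror.
Qed.

Lemma comp_zeror A B D (f : hom A B) : f ∙ hzero B D ≡ hzero A D.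
Proof.
apply: (@hadd_cancel _ _ (f ∙ hzero B D)).
by rewrite -comp_addr hadd_zerol hadd_zeror.
Qed.

Lemma comp_oppl A B D (f : hom A B) (g : hom B D) : hopp f ∙ g ≡ hopp (f ∙ g).
Proof.
apply: (@hadd_cancel _ _ (f ∙ g)).
by rewrite -comp_addl !hadd_oppr comp_zerol.
Qed.

Lemma comp_oppr A B D (f : hom A B) (g : hom B D) : f ∙ hopp g ≡ hopp (f ∙ g).
Proof.
apply: (@hadd_cancel _ _ (f ∙ g)).
by rewrite -comp_addr !hadd_oppr comp_zeror.
Qed.

Lemma hsubP A B (f g h : hom A B) : h ≡ f ⊟ g <-> f ≡ g ⊞ h.
Proof.
split=> e; rewrite e.
  by rewrite hadd_comm -hadd_assoc hadd_oppl hadd_zeror.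
by rewrite (hadd_comm g) -hadd_assoc hadd_oppr hadd_zeror.
Qed.

Definition hsum A B n (F : 'I_n -> hom A B) : hom A B :=
  \big[hadd/hzero A B]_(j < n) F j.

Lemma eqv_hsum A B n (F G : 'I_n -> hom A B) :
  (forall j, F j ≡ G j) -> hsum F ≡ hsum G.
Proof.
move=> e; rewrite /hsum.
by elim/big_ind2: _ => // f f' g g' -> ->.
Qed.

Lemma hsum_zero A B n : hsum (fun _ : 'I_n => hzero A B) ≡ hzero A B.
Proof.
rewrite /hsum; elim/big_ind: _ => // f g -> ->; exact: hadd_zerol.
Qed.

Lemma hsum_add A B n (F G : 'I_n -> hom A B) :
  hsum (fun j => F j ⊞ G j) ≡ hsum F ⊞ hsum G.
Proof.
rewrite /hsum; elim/big_rec3: _ => [|j x y z _ ->]; first by rewrite hadd_zerol.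
exact: hadd_acac.
Qed.

Lemma comp_hsuml A B D n (F : 'I_n -> hom A B) (g : hom B D) :
  hsum F ∙ g ≡ hsum (fun j => F j ∙ g).
Proof.
rewrite /hsum; elim/big_rec2: _ => [|j x y _ e]; first exact: comp_zerol.
by rewrite comp_addl e.
Qed.

Lemma comp_hsumr A B D n (f : hom A B) (G : 'I_n -> hom B D) :
  f ∙ hsum G ≡ hsum (fun j => f ∙ G j).
Proof.
rewrite /hsum; elim/big_rec2: _ => [|j x y _ e]; first exact: comp_zeror.
by rewrite comp_addr e.
Qed.

Lemma exchange_hsum A B m n (F : 'I_m -> 'I_n -> hom A B) :
  hsum (fun i => hsum (F i)) ≡ hsum (fun j => hsum (fun i => F i j)).
Proof.
elim: m F => [|m IHm] F.
  rewrite {1}/hsum big_ord0 -{1}(@hsum_zero _ _ n); apply: eqv_hsum => j.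
  by rewrite /hsum big_ord0.
rewrite {1}/hsum big_ord_recl -/(hsum _) (IHm (fun i => F (lift ord0 i))).
rewrite -hsum_add; apply: eqv_hsum => j.
by rewrite [X in _ ≡ X]/hsum big_ord_recl.
Qed.

Lemma hsum_single A B n (F : 'I_n -> hom A B) (i : 'I_n) :
  (forall j, j != i -> F j ≡ hzero A B) -> hsum F ≡ F i.
Proof.
elim: n F i => [|n IHn] F i; first by case: i.
case: (unliftP ord0 i) => [k ->|->] e; rewrite /hsum big_ord_recl -/(hsum _).
  rewrite e // hadd_zerol (IHn (fun j => F (lift ord0 j)) k) // => j nj.
  by apply: e; apply: contra nj => /eqP /lift_inj ->.
rewrite (@eqv_hsum _ _ _ _ (fun _ => hzero A B)) => [|j]; last exact: e.
by rewrite hsum_zero hadd_zeror.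
Qed.

End AbTheory.

Definition op_ab (C : ab_category) : ab_category.
Proof.
refine (@AbCategory (op_cat C) (fun A B => hzero B A) (fun A B f => hopp f)
  (fun A B f g => f ⊞ g) _ _ _ _ _ _ _ _).
- by move=> A B f g h; exact: hadd_assoc.
- by move=> A B f g; exact: hadd_comm.
- by move=> A B f; exact: hadd_zerol.
- by move=> A B f; exact: hadd_oppl.
- by move=> A B D f g h; exact: comp_addr.
- by move=> A B D f g h; exact: comp_addl.
Defined.

Definition full_subcat (C : category) (P : C -> Prop) : category.
Proof.
refine (@Category {X : C | P X} (fun X Y => hom (sval X) (sval Y))
  (fun X Y f g => f ≡ g) (fun X => idm (sval X)) (fun X Y Z f g => f ∙ g)
  (fun X Y => eqv_equiv _ _) (fun X Y Z => @comp_proper C _ _ _) _ _ _).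
- by move=> X Y f; exact: comp_idl.
- by move=> X Y f; exact: comp_idr.
- by move=> X Y Z W f g h; exact: comp_assoc.
Defined.

Definition full_subcategory (C : ab_category) (P : C -> Prop) : ab_category.
Proof.
refine (@AbCategory (full_subcat P)
  (fun X Y => hzero (sval X) (sval Y)) (fun X Y f => hopp f)
  (fun X Y f g => f ⊞ g)
  (fun X Y => @hopp_proper C _ _) (fun X Y => @hadd_proper C _ _) _ _ _ _ _ _).
- by move=> X Y f g h; exact: hadd_assoc.
- by move=> X Y f g; exact: hadd_comm.
- by move=> X Y f; exact: hadd_zerol.
- by move=> X Y f; exact: hadd_oppl.
- by move=> X Y Z f g h; exact: comp_addl.
- by move=> X Y Z f g h; exact: comp_addr.
Defined.

Definition is_cokernel (C : ab_category) (A B Q : C) (f : hom A B) (q : hom B Q) :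
  Prop :=
  f ∙ q ≡ hzero A Q /\
  forall (T : C) (t : hom B T), f ∙ t ≡ hzero A T ->
    exists2 u : hom Q T, q ∙ u ≡ t & forall u' : hom Q T, q ∙ u' ≡ t -> u' ≡ u.

Definition additive_functor (C D : ab_category) (F : functor C D) : Prop :=
  forall (A B : C) (f g : hom A B), fmap F (f ⊞ g) ≡ fmap F f ⊞ fmap F g.

Section NaturalGroup.
Variables (C : category) (D : ab_category) (F G : functor C D).

Definition natural_zero : natural F G.
Proof.
exists (fun A => hzero (F A) (G A)).
by move=> A B f; rewrite comp_zerol comp_zeror.
Defined.

Definition natural_opp (s : natural F G) : natural F G.
Proof.
exists (fun A => hopp (s A)).
by move=> A B f; rewrite comp_oppl comp_oppr ntE.
Defined.

Definition natural_add (s t : natural F G) : natural F G.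
Proof.
exists (fun A => s A ⊞ t A).
by move=> A B f; rewrite comp_addl comp_addr !ntE.
Defined.

End NaturalGroup.

Definition functor_ab (C : category) (D : ab_category) : ab_category.
Proof.
refine (@AbCategory (functor_cat C D) (@natural_zero C D) (@natural_opp C D)
  (@natural_add C D) _ _ _ _ _ _ _ _).
- by move=> F G s t e A; exact: (@hopp_proper D _ _ _ _ (e A)).
- by move=> F G s t e s' t' e' A; exact: (@hadd_proper D _ _ _ _ (e A) _ _ (e' A)).
- by move=> F G s t u A; exact: hadd_assoc.
- by move=> F G s t A; exact: hadd_comm.
- by move=> F G s A; exact: hadd_zerol.
- by move=> F G s A; exact: hadd_oppl.
- by move=> F G K s t u A; exact: comp_addl.
- by move=> F G K s t u A; exact: comp_addr.
Defined.

Definition additive_functors (C D : ab_category) : ab_category :=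
  @full_subcategory (functor_ab C D) (@additive_functor C D).

Definition ring_cat (R : comPzRingType) : category.
Proof.
refine (@Category unit (fun _ _ => R) (fun _ _ => @eq R) (fun _ => 1)
  (fun _ _ _ r s => r * s) (fun _ _ => eq_equivalence) _ _ _ _).
- by move=> A B r; exact: mul1r.
- by move=> A B r; exact: mulr1.
- by move=> A B D E r s t; rewrite /= mulrA.
Defined.

Definition ring_category (R : comPzRingType) : ab_category.
Proof.
refine (@AbCategory (ring_cat R) (fun _ _ => 0) (fun _ _ r => - r)
  (fun _ _ r s => r + s) _ _ _ _ _ _ _ _).
- by move=> A B r s t; exact: addrA.
- by move=> A B r s; exact: addrC.
- by move=> A B r; exact: add0r.
- by move=> A B r; exact: addNr.
- by move=> A B D r s t; exact: mulrDl.
- by move=> A B D r s t; exact: mulrDr.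
Defined.

Section AdditiveClosure.
Variable C : ab_category.

(** The list [A_1, ..., A_m], as its length and its items. *)
Record object_list := ObjectList {
  ol_size : nat;
  ol_item :> 'I_ol_size -> C
}.

Definition mor_matrix (s t : object_list) : Type :=
  forall (i : 'I_(ol_size s)) (j : 'I_(ol_size t)), hom (s i) (t j).

(** Off the diagonal the entry is zero; on it, the equation [i = j] is needed to
    give the identity the type [hom s_i s_j]. *)
Definition id_matrix (s : object_list) : mor_matrix s s := fun i j =>
  match i =P j with
  | ReflectT e => ecast k (hom (s i) (s k)) e (idm (s i))
  | ReflectF _ => hzero _ _
  end.

Arguments id_matrix s i j : clear implicits.

Lemma id_matrix_diag (s : object_list) i : id_matrix s i i = idm (s i).
Proof.
rewrite /id_matrix; case: eqP => // e.
by rewrite (eq_irrelevance e (erefl i)).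
Qed.

Lemma id_matrix_off (s : object_list) i j : i != j -> id_matrix s i j = hzero _ _.
Proof. by rewrite /id_matrix; case: eqP. Qed.

Definition comp_matrix (s t u : object_list)
  (a : mor_matrix s t) (b : mor_matrix t u) : mor_matrix s u :=
  fun i k => hsum (fun j => a i j ∙ b j k).

Definition matrix_cat : category.
Proof.
refine (@Category object_list mor_matrix (fun s t a b => forall i j, a i j ≡ b i j)
  id_matrix comp_matrix _ _ _ _ _).
- move=> s t; split=> [a i j|a b e i j|a b c e e' i j] //.
  + by rewrite e.
  + by rewrite e.
- move=> s t u a a' ea b b' eb i k; apply: eqv_hsum => j.
  by rewrite (ea i j) (eb j k).
- move=> s t a i k; rewrite /comp_matrix (hsum_single (i := i)) => [|j nj].
    by rewrite id_matrix_diag comp_idl.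
  by rewrite id_matrix_off ?comp_zerol // eq_sym.
- move=> s t a i k; rewrite /comp_matrix (hsum_single (i := k)) => [|j nj].
    by rewrite id_matrix_diag comp_idr.
  by rewrite id_matrix_off ?comp_zeror.
- move=> s t u v a b c i l; rewrite /comp_matrix.
  rewrite (eqv_hsum (fun k => comp_hsuml _ (c k l))) exchange_hsum.
  apply: eqv_hsum => j; rewrite comp_hsumr; apply: eqv_hsum => k.
  exact: comp_assoc.
Defined.

Definition additive_closure : ab_category.
Proof.
refine (@AbCategory matrix_cat (fun s t i j => hzero _ _)
  (fun s t a i j => hopp (a i j)) (fun s t a b i j => a i j ⊞ b i j)
  _ _ _ _ _ _ _ _).
- by move=> s t a b e i j; rewrite (e i j).
- by move=> s t a b e a' b' e' i j; rewrite (e i j) (e' i j).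
- by move=> s t a b c i j; exact: hadd_assoc.
- by move=> s t a b i j; exact: hadd_comm.
- by move=> s t a i j; exact: hadd_zerol.
- by move=> s t a i j; exact: hadd_oppl.
- move=> s t u a b c i k /=; rewrite /comp_matrix -hsum_add.
  by apply: eqv_hsum => j; exact: comp_addl.
- move=> s t u a b c i k /=; rewrite /comp_matrix -hsum_add.
  by apply: eqv_hsum => j; exact: comp_addr.
Defined.

End AdditiveClosure.

(** The Freyd category. The construction uses only the Ab-category structure of
    [C], so it is not restricted to additive categories. *)

Section Freyd.
Variable C : ab_category.

Record freyd_ob := FreydOb {
  fr_gen : C;
  fr_rel : C;
  fr_rho : hom fr_rel fr_gen
}.

Definition freyd_hom (X Y : freyd_ob) : Type :=
  {f : hom (fr_gen X) (fr_gen Y) |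
    exists r : hom (fr_rel X) (fr_rel Y), fr_rho X ∙ f ≡ r ∙ fr_rho Y}.

Definition freyd_eqv (X Y : freyd_ob) (f g : freyd_hom X Y) : Prop :=
  exists l : hom (fr_gen X) (fr_rel Y), l ∙ fr_rho Y ≡ sval f ⊟ sval g.

Lemma freyd_eqvP (X Y : freyd_ob) (f g : freyd_hom X Y) :
  freyd_eqv f g <->
  exists l : hom (fr_gen X) (fr_rel Y), sval f ≡ sval g ⊞ l ∙ fr_rho Y.
Proof. by split=> -[l e]; exists l; apply/hsubP. Qed.

Lemma freyd_eqv_sub (X Y : freyd_ob) (f g : freyd_hom X Y) :
  sval f ≡ sval g -> freyd_eqv f g.
Proof.
by move=> e; exists (hzero _ _); rewrite e comp_zerol hadd_oppr.
Qed.

Definition freyd_id (X : freyd_ob) : freyd_hom X X.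
Proof.
exists (idm (fr_gen X)); exists (idm (fr_rel X)).
by rewrite comp_idl comp_idr.
Defined.

Definition freyd_comp (X Y Z : freyd_ob) (f : freyd_hom X Y) (g : freyd_hom Y Z) :
  freyd_hom X Z.
Proof.
exists (sval f ∙ sval g).
case: f g => [f [r er]] [g [s es]]; exists (r ∙ s) => /=.
by rewrite -comp_assoc er !comp_assoc es.
Defined.

Definition freyd_zero (X Y : freyd_ob) : freyd_hom X Y.
Proof.
exists (hzero _ _); exists (hzero _ _).
by rewrite comp_zerol comp_zeror.
Defined.

Definition freyd_opp (X Y : freyd_ob) (f : freyd_hom X Y) : freyd_hom X Y.
Proof.
exists (hopp (sval f)).
case: f => [f [r er]]; exists (hopp r) => /=.
by rewrite comp_oppr comp_oppl er.
Defined.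

Definition freyd_add (X Y : freyd_ob) (f g : freyd_hom X Y) : freyd_hom X Y.
Proof.
exists (sval f ⊞ sval g).
case: f g => [f [r er]] [g [s es]]; exists (r ⊞ s) => /=.
by rewrite comp_addl comp_addr er es.
Defined.

Lemma freyd_equiv (X Y : freyd_ob) : Equivalence (@freyd_eqv X Y).
Proof.
split=> [f|f g /freyd_eqvP[l e]|f g h /freyd_eqvP[l e] /freyd_eqvP[l' e']].
- exact: freyd_eqv_sub.
- apply/freyd_eqvP; exists (hopp l).
  by rewrite e -hadd_assoc comp_oppl hadd_oppr hadd_zeror.
- apply/freyd_eqvP; exists (l' ⊞ l).
  by rewrite e e' -hadd_assoc comp_addl.
Qed.

Lemma freyd_comp_proper (X Y Z : freyd_ob) :
  Proper (@freyd_eqv X Y ==> @freyd_eqv Y Z ==> @freyd_eqv X Z)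
    (@freyd_comp X Y Z).
Proof.
move=> f f' /freyd_eqvP[l e] g g' /freyd_eqvP[m e']; apply/freyd_eqvP.
case: g g' e' => [g [r er]] [g' hg'] /= e'.
exists (sval f' ∙ m ⊞ l ∙ r).
rewrite e comp_addl {1}e' comp_addr comp_addl !comp_assoc er.
by rewrite hadd_assoc.
Qed.

Lemma freyd_opp_proper (X Y : freyd_ob) :
  Proper (@freyd_eqv X Y ==> @freyd_eqv X Y) (@freyd_opp X Y).
Proof.
move=> f g [l e]; exists (hopp l); rewrite /= comp_oppl e.
apply: (@hadd_cancel _ _ _ (sval f ⊟ sval g)).
by rewrite hadd_oppr hadd_acac hadd_oppr hadd_oppr hadd_zerol.
Qed.

Lemma freyd_add_proper (X Y : freyd_ob) :
  Proper (@freyd_eqv X Y ==> @freyd_eqv X Y ==> @freyd_eqv X Y) (@freyd_add X Y).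
Proof.
move=> f f' /freyd_eqvP[l e] g g' /freyd_eqvP[m e']; apply/freyd_eqvP.
by exists (l ⊞ m); rewrite /= e e' comp_addl hadd_acac.
Qed.

Definition freyd_cat : category.
Proof.
refine (@Category freyd_ob freyd_hom freyd_eqv freyd_id freyd_comp
  freyd_equiv freyd_comp_proper _ _ _).
- by move=> X Y f; apply: freyd_eqv_sub; exact: comp_idl.
- by move=> X Y f; apply: freyd_eqv_sub; exact: comp_idr.
- by move=> X Y Z W f g h; apply: freyd_eqv_sub; exact: comp_assoc.
Defined.

Definition freyd_category : ab_category.
Proof.
refine (@AbCategory freyd_cat freyd_zero freyd_opp freyd_add
  freyd_opp_proper freyd_add_proper _ _ _ _ _ _).
- by move=> X Y f g h; apply: freyd_eqv_sub; exact: hadd_assoc.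
- by move=> X Y f g; apply: freyd_eqv_sub; exact: hadd_comm.
- by move=> X Y f; apply: freyd_eqv_sub; exact: hadd_zerol.
- by move=> X Y f; apply: freyd_eqv_sub; exact: hadd_oppl.
- by move=> X Y Z f g h; apply: freyd_eqv_sub; exact: comp_addl.
- by move=> X Y Z f g h; apply: freyd_eqv_sub; exact: comp_addr.
Defined.

End Freyd.

(** A [B]-homomorphism structure for [A], with distinguished object [hs_one] and
    [hs_nu] bijective up to [eqv]. *)
Record hom_structure (A B : ab_category) := HomStructure {
  hs_one : B;
  hs_H : functor (prod_cat (op_cat A) A) B;
  hs_H_addl : forall (X X' Y Y' : A) (f g : hom X' X) (h : hom Y Y'),
    @fmap _ _ hs_H (X, Y) (X', Y') (f ⊞ g, h)
      ≡ @fmap _ _ hs_H (X, Y) (X', Y') (f, h) ⊞ @fmap _ _ hs_H (X, Y) (X', Y') (g, h);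
  hs_H_addr : forall (X X' Y Y' : A) (f : hom X' X) (g h : hom Y Y'),
    @fmap _ _ hs_H (X, Y) (X', Y') (f, g ⊞ h)
      ≡ @fmap _ _ hs_H (X, Y) (X', Y') (f, g) ⊞ @fmap _ _ hs_H (X, Y) (X', Y') (f, h);
  hs_nu : forall X Y : A, hom X Y -> hom hs_one (hs_H (X, Y));
  hs_nu_proper : forall X Y, Proper (eqv ==> eqv) (@hs_nu X Y);
  hs_nu_inj : forall (X Y : A) (f g : hom X Y), hs_nu f ≡ hs_nu g -> f ≡ g;
  hs_nu_surj : forall (X Y : A) (u : hom hs_one (hs_H (X, Y))),
    exists f : hom X Y, hs_nu f ≡ u;
  hs_nu_natural : forall (X X' Y Y' : A) (f : hom X' X) (x : hom X Y) (g : hom Y Y'),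
    hs_nu (f ∙ x ∙ g) ≡ hs_nu x ∙ @fmap _ _ hs_H (X, Y) (X', Y') (f, g)
}.

Definition admits_hom_structure (A B : ab_category) : Prop :=
  inhabited (hom_structure A B).

Definition Ab_cat : category.
Proof.
refine (@Category zmodType (fun U V => {additive U -> V}) (fun U V f g => f =1 g)
  (fun U => idfun) (fun U V W f g => g \o f) _ _ _ _ _) => //.
- move=> U V; split=> [f x|f g e x|f g h e e' x] //.
  by rewrite e e'.
- by move=> U V W f f' e g g' e' x /=; rewrite e e'.
Defined.

Definition Ab : ab_category.
Proof.
refine (@AbCategory Ab_cat (fun U V => \0) (fun U V f => \- f)
  (fun U V f g => f \+ g) _ _ _ _ _ _ _ _).
- by move=> U V f g e x /=; rewrite e.
- by move=> U V f g e f' g' e' x /=; rewrite e e'.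
- by move=> U V f g h x; exact: addrA.
- by move=> U V f g x; exact: addrC.
- by move=> U V f x; exact: add0r.
- by move=> U V f x; exact: addNr.
- by move=> U V W f g h x /=; rewrite raddfD.
- by [].
Defined.

Section LinearMaps.
Variables (R : comPzRingType) (M N : lmodType R).
Implicit Types f g h : {linear M -> N}.

Lemma linear_inj f g : f =1 g -> f = g.
Proof.
case: f g => f cf [g cg] /= /funext e.
case: _ / e cg => cg; congr GRing.Linear.Pack.
case: cf cg => [[a1] [b1]] [[a2] [b2]].
by rewrite (Prop_irrelevance a1 a2) (Prop_irrelevance b1 b2).
Qed.

HB.instance Definition _ := gen_eqMixin {linear M -> N}.
HB.instance Definition _ := gen_choiceMixin {linear M -> N}.

Definition linear_zero : {linear M -> N} := \0.
Definition linear_opp f : {linear M -> N} := \- f.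
Definition linear_add f g : {linear M -> N} := f \+ g.

Lemma linear_addA : associative linear_add.
Proof. by move=> f g h; apply: linear_inj => x; exact: addrA. Qed.
Lemma linear_addC : commutative linear_add.
Proof. by move=> f g; apply: linear_inj => x; exact: addrC. Qed.
Lemma linear_add0 : left_id linear_zero linear_add.
Proof. by move=> f; apply: linear_inj => x; exact: add0r. Qed.
Lemma linear_addN : left_inverse linear_zero linear_opp linear_add.
Proof. by move=> f; apply: linear_inj => x; exact: addNr. Qed.

HB.instance Definition _ := GRing.isZmodule.Build {linear M -> N}
  linear_addA linear_addC linear_add0 linear_addN.

End LinearMaps.

Section FinitelyPresented.
Variable R : comPzRingType.

Definition fg_free (M : lmodType R) : Prop :=
  exists n (f : {linear 'rV[R]_n -> M}), bijective f.

Definition fg_submodule (M : lmodType R) (S : M -> Prop) : Prop :=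
  exists n (g : 'I_n -> M),
    forall x, S x <-> exists c : 'I_n -> R, x = \sum_(i < n) c i *: g i.

Definition coherent : Prop :=
  forall (M N : lmodType R) (f : {linear M -> N}),
    fg_free M -> fg_free N -> fg_submodule (fun x => f x = 0).

Definition finitely_presented (M : lmodType R) : Prop :=
  exists m n (f : {linear 'rV[R]_m -> 'rV[R]_n}) (p : {linear 'rV[R]_n -> M}),
    (forall y, exists x, p x = y) /\
    (forall x, p x = 0 <-> exists z, f z = x).

Record fpmod := FpMod {
  fp_module :> lmodType R;
  fp_moduleP : finitely_presented fp_module
}.

Definition fpmod_cat : category.
Proof.
refine (@Category fpmod (fun M N => {linear M -> N}) (fun M N f g => f =1 g)
  (fun M => idfun) (fun M N P f g => g \o f) _ _ _ _ _) => //.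
- move=> M N; split=> [f x|f g e x|f g h e e' x] //.
  by rewrite e e'.
- by move=> M N P f f' e g g' e' x /=; rewrite e e'.
Defined.

Definition fpmod_category : ab_category.
Proof.
refine (@AbCategory fpmod_cat (fun M N => \0) (fun M N f => \- f)
  (fun M N f g => f \+ g) _ _ _ _ _ _ _ _).
- by move=> M N f g e x /=; rewrite e.
- by move=> M N f g e f' g' e' x /=; rewrite e e'.
- by move=> M N f g h x; exact: addrA.
- by move=> M N f g x; exact: addrC.
- by move=> M N f x; exact: add0r.
- by move=> M N f x; exact: addNr.
- by move=> M N P f g h x /=; rewrite raddfD.
- by [].
Defined.

Section PostComposition.
Variables (A M N : lmodType R) (f : {linear M -> N}).

Definition linear_postcomp (g : {linear A -> M}) : {linear A -> N} := f \o g.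

Lemma linear_postcomp_sub : zmod_morphism linear_postcomp.
Proof. by move=> g h; apply: linear_inj => x; rewrite /= raddfB. Qed.

HB.instance Definition _ := GRing.isZmodMorphism.Build
  {linear A -> M} {linear A -> N} linear_postcomp linear_postcomp_sub.

End PostComposition.

Definition hom_functor (A : fpmod) : functor fpmod_category Ab.
Proof.
refine (@Functor fpmod_category Ab (fun M => ({linear A -> M} : zmodType))
  (fun M N f => linear_postcomp f : {additive _ -> _}) _ _ _).
- by move=> M N f g e h; apply: linear_inj => x; exact: e.
- by move=> M h; apply: linear_inj.
- by move=> M N P f g h; apply: linear_inj.
Defined.

Lemma hom_functor_additive (A : fpmod) : additive_functor (hom_functor A).
Proof. by move=> M N f g h; apply: linear_inj. Qed.

Definition representable (A : fpmod) : additive_functors fpmod_category Ab :=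
  exist _ (hom_functor A) (@hom_functor_additive A).

Definition fp_functor (F : additive_functors fpmod_category Ab) : Prop :=
  exists (A B : fpmod) (eta : hom (representable B) (representable A))
    (pi : hom (representable A) F), is_cokernel eta pi.

Definition fp_functors : ab_category := full_subcategory fp_functor.

End FinitelyPresented.

(* Main.v *)
From Stdlib Require Import Setoid Morphisms.
From HB Require Import structures.
From mathcomp Require Import all_boot all_algebra boolp.
Require Import Defs.

Set Implicit Arguments.
Unset Strict Implicit.
Unset Printing Implicit Defensive.

Import GRing.Theory.
Local Open Scope ring_scope.
Local Open Scope cat_scope.

(** Write P for the Freyd category of free modules. Both halves of the theorem rest
    on reading an object of P, a matrix rho, as the module presented by rho.

    Equivalence. Sending rho to its cokernel is an additive weak equivalence (full,
    faithful, essentially surjective) from P to finitely presented modules: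
    matrices between generators that respect relations, modulo those factoring
    through relations, are exactly the linear maps of cokernels
    ([pres_functor_weak_equivalence]). Passing to opposite categories and to Freyd
    categories preserves additive weak equivalences
    ([freyd_map_weak_equivalence]), so P may be replaced by the category of finitely
    presented modules. An object of the Freyd category of its opposite is a linear
    map G -> K; it is sent to the cokernel of Hom(K, -) -> Hom(G, -), formed
    pointwise. The Yoneda lemma makes this assignment a weak equivalence onto finitely
    presented functors ([fp_cokernel_functor_weak_equivalence]): a natural
    transformation of cokernels is determined by the image of the class of the
    identity of G. Choice turns a weak equivalence into an equivalence.

    Homomorphism structure. Maps in P from the free module on one generator to rho
    are the elements of the module presented by rho. So it suffices that every
    hom-group of the double Freyd category, with its R-module structure, is
    finitely presented: H(X, Y) is then a presentation of Hom(X, Y), H is defined on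
    morphisms by lifting f . - . g to presentations, and functoriality,
    bilinearity and naturality hold because maps between presented modules are
    determined by their effect on elements ([fp_homs_hom_structure]). Hom-modules
    between free modules are free, and for coherent R finite presentation
    of hom-modules is inherited by Freyd categories ([freyd_fp_homs]): a hom-module
    of a Freyd category is a quotient of two submodules, each the projection of the
    solution set of a linear system, and over a coherent ring such
    projections are finitely generated ([projection_fg]). This applies twice,
    with a passage to the opposite category in between. *)

(** * Weak equivalences *)

Definition full (C D : category) (F : functor C D) : Prop :=
  forall (A B : C) (h : hom (F A) (F B)), exists f : hom A B, fmap F f ≡ h.

Definition faithful (C D : category) (F : functor C D) : Prop :=
  forall (A B : C) (f g : hom A B), fmap F f ≡ fmap F g -> f ≡ g.

Definition ess_surj (C D : category) (F : functor C D) : Prop :=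
  forall B : D, exists A : C, isomorphic (F A) B.

Definition weak_equivalence (C D : category) (F : functor C D) : Prop :=
  [/\ full F, faithful F & ess_surj F].

(** The inverse is chosen on objects by essential surjectivity; on morphisms it is
    the unique lift of the conjugate by the chosen isomorphisms. *)
Lemma weak_equivalence_equivalent (C D : category) (F : functor C D) :
  weak_equivalence F -> equivalent C D.
Proof.
case=> fullF faithF essF.
pose G B := sval (cid (essF B)).
have isoP B : {i : hom (F (G B)) B & {j : hom B (F (G B)) |
    i ∙ j ≡ idm _ /\ j ∙ i ≡ idm _}}.
  have [i /cid [j e]] := cid (svalP (cid (essF B))).
  by exists i; exists j.
pose i B := projT1 (isoP B); pose j B := sval (projT2 (isoP B)).
have ij B : i B ∙ j B ≡ idm _ by have [] := svalP (projT2 (isoP B)).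
have ji B : j B ∙ i B ≡ idm _ by have [] := svalP (projT2 (isoP B)).
pose lift A A' (h : hom (F A) (F A')) := sval (cid (fullF A A' h)).
have liftE A A' h : fmap F (@lift A A' h) ≡ h := svalP (cid (fullF A A' h)).
pose Gmap B B' (b : hom B B') : hom (G B) (G B') := lift _ _ (i B ∙ b ∙ j B').
have GmapE B B' (b : hom B B') : fmap F (Gmap _ _ b) ≡ i B ∙ b ∙ j B' := liftE _ _ _.
unshelve epose (Gf := @Functor D C G Gmap _ _ _).
- by move=> B B' b b' e; apply: faithF; rewrite !GmapE e.
- by move=> B; apply: faithF; rewrite GmapE comp_idr fmap_id ij.
- move=> B B' B'' b b'; apply: faithF; rewrite fmap_comp !GmapE -!comp_assoc.
  by rewrite (comp_assoc (i B ∙ b) (j B')) ji comp_idr.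
exists F, Gf; split.
- unshelve eexists.
    exists (fun A => lift _ _ (i (F A)) : hom (functor_comp F Gf A) (functor_id C A)).
    move=> A A' f /=; apply: (@faithF); rewrite !fmap_comp GmapE !liftE.
    by rewrite comp_assoc ji comp_idr.
  unshelve eexists.
    exists (fun A => lift _ _ (j (F A)) : hom (functor_id C A) (functor_comp F Gf A)).
    move=> A A' f /=; apply: (@faithF); rewrite !fmap_comp GmapE !liftE.
    by rewrite -!comp_assoc ji comp_idl.
  by split=> A /=; apply: (@faithF); rewrite fmap_comp fmap_id !liftE ?ij ?ji.
- unshelve eexists.
    exists (fun B => i B : hom (functor_comp Gf F B) (functor_id D B)).
    by move=> B B' b /=; rewrite GmapE comp_assoc ji comp_idr.
  unshelve eexists.
    exists (fun B => j B : hom (functor_id D B) (functor_comp Gf F B)).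
    by move=> B B' b /=; rewrite GmapE -!comp_assoc ji comp_idl.
  by split=> B /=.
Qed.

Lemma fmap_isomorphic (C D : category) (F : functor C D) (A B : C) :
  isomorphic A B -> isomorphic (F A) (F B).
Proof.
case=> i [j [ij ji]]; exists (fmap F i), (fmap F j).
by split; rewrite -fmap_comp; [rewrite ij|rewrite ji]; rewrite fmap_id.
Qed.

Lemma isomorphic_trans (C : category) (X Y Z : C) :
  isomorphic X Y -> isomorphic Y Z -> isomorphic X Z.
Proof.
case=> i [j [ij ji]] [i' [j' [ij' ji']]]; exists (i ∙ i'), (j' ∙ j); split.
  by rewrite comp_assoc -(comp_assoc i') ij' comp_idl.
by rewrite comp_assoc -(comp_assoc j) ji comp_idl.
Qed.

Lemma weak_equivalence_comp (C D E : category) (F : functor C D) (G : functor D E) :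
  weak_equivalence F -> weak_equivalence G -> weak_equivalence (functor_comp F G).
Proof.
move=> [fullF faithF essF] [fullG faithG essG]; split.
- move=> A B h; have [g eg] := fullG _ _ h; have [f e] := fullF _ _ g.
  by exists f; rewrite /= e eg.
- by move=> A B f g /faithG/faithF.
- move=> Z; have [Y iY] := essG Z; have [X iX] := essF Y; exists X.
  exact: isomorphic_trans (fmap_isomorphic G iX) iY.
Qed.

Definition op_functor (C D : ab_category) (F : functor C D) :
  functor (op_ab C) (op_ab D).
Proof.
exists (fun A : op_ab C => F A : op_ab D) (fun A B (f : @hom (op_ab C) A B) => fmap F f).
- by move=> A B f g e; apply: fmap_proper.
- by move=> A; exact: fmap_id.
- by move=> A B E f g; exact: fmap_comp.
Defined.

Lemma op_functor_additive (C D : ab_category) (F : functor C D) :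
  additive_functor F -> additive_functor (op_functor F).
Proof. by move=> addF A B f g; exact: addF. Qed.

Lemma op_functor_weak_equivalence (C D : ab_category) (F : functor C D) :
  weak_equivalence F -> weak_equivalence (op_functor F).
Proof.
case=> fullF faithF essF; split.
- by move=> A B h; exact: fullF.
- by move=> A B f g; exact: faithF.
- by move=> B; have [A [i [j [ij ji]]]] := essF B; exists A, j, i.
Qed.

(** Morphisms of a full subcategory are those of the ambient one, so a functor is
    studied in the ambient category and its codomain is cut down afterwards. *)
Section Corestriction.
Variables (C : category) (D : ab_category) (P : D -> Prop) (F : functor C D).
Hypothesis FP : forall A : C, P (F A).

Definition corestrict : functor C (full_subcategory P).
Proof.
exists (fun A => exist P (F A) (FP A) : full_subcategory P) (fun A B f => fmap F f).
- by move=> A B f g e; apply: fmap_proper.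
- by move=> A; exact: fmap_id.
- by move=> A B E f g; exact: fmap_comp.
Defined.

Lemma corestrict_full : full F -> full corestrict.
Proof. by move=> fullF A B h; exact: fullF. Qed.

Lemma corestrict_faithful : faithful F -> faithful corestrict.
Proof. by move=> faithF A B f g; exact: faithF. Qed.

Lemma corestrict_ess_surj :
  (forall B : D, P B -> exists A : C, isomorphic (F A) B) -> ess_surj corestrict.
Proof.
by move=> essF [B PB]; have [A [i [j ij]]] := essF B PB; exists A, i, j.
Qed.

End Corestriction.

(** * Functoriality of the Freyd category *)

(** Composites and underlying morphisms are rewritten through these equations of
    abstract categories, since unfolding them in concrete categories is expensive. *)
Lemma op_compE (C : ab_category) (X Y Z : op_ab C) (f : hom X Y) (g : hom Y Z) :
  f ∙ g = @comp C _ _ _ g f.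
Proof. by []. Qed.

Definition freyd_val (C : ab_category) (X Y : freyd_category C) (f : hom X Y) :
  hom (fr_gen X) (fr_gen Y) := sval f.

Lemma freyd_val_comp (C : ab_category) (X Y Z : freyd_category C)
    (f : hom X Y) (g : hom Y Z) :
  freyd_val (f ∙ g) = freyd_val f ∙ freyd_val g.
Proof. by []. Qed.

Section FreydMap.
Variables (C D : ab_category) (F : functor C D).
Hypothesis addF : additive_functor F.

Lemma fmap_opp (A B : C) (f : hom A B) : fmap F (hopp f) ≡ hopp (fmap F f).
Proof.
have F0 : fmap F (hzero A B) ≡ hzero _ _.
  apply: (@hadd_cancel _ _ _ (fmap F (hzero A B))); by rewrite -addF !hadd_zeror.
by apply: (@hadd_cancel _ _ _ (fmap F f)); rewrite -addF !hadd_oppr.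
Qed.

Definition freyd_map_ob (X : freyd_category C) : freyd_category D :=
  FreydOb (fmap F (fr_rho X)).

Definition freyd_map_hom (X Y : freyd_category C) (f : hom X Y) :
  hom (freyd_map_ob X) (freyd_map_ob Y).
Proof.
exists (fmap F (sval f)); case: f => f [r e]; exists (fmap F r).
by rewrite /= -!fmap_comp e.
Defined.

Definition freyd_map : functor (freyd_category C) (freyd_category D).
Proof.
exists freyd_map_ob freyd_map_hom.
- move=> X Y f g [l e]; exists (fmap F l).
  by rewrite /= -fmap_comp e addF fmap_opp.
- by move=> X; apply: freyd_eqv_sub; exact: fmap_id.
- by move=> X Y Z f g; apply: freyd_eqv_sub; exact: fmap_comp.
Defined.

Lemma freyd_iso (X Y : freyd_category D) (i : hom (fr_gen X) (fr_gen Y))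
    (j : hom (fr_gen Y) (fr_gen X)) (k : hom (fr_rel X) (fr_rel Y))
    (l : hom (fr_rel Y) (fr_rel X)) :
  i ∙ j ≡ idm _ -> j ∙ i ≡ idm _ ->
  fr_rho X ∙ i ≡ k ∙ fr_rho Y -> fr_rho Y ∙ j ≡ l ∙ fr_rho X -> isomorphic X Y.
Proof.
move=> ij ji ek el.
exists (exist _ i (ex_intro _ k ek)), (exist _ j (ex_intro _ l el)).
by split; apply: freyd_eqv_sub.
Qed.

(** Fullness of [F] lifts a morphism, its witness on relations and the homotopies that
    make it zero; faithfulness carries the equations between them back to [C]. *)
Lemma freyd_map_weak_equivalence :
  weak_equivalence F -> weak_equivalence freyd_map.
Proof.
case=> fullF faithF essF; split.
- move=> X Y [h [r e]] /=; have [f ef] := fullF _ _ h; have [s es] := fullF _ _ r.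
  have ers : fr_rho X ∙ f ≡ s ∙ fr_rho Y.
    by apply: faithF; rewrite !fmap_comp ef es; exact: e.
  by exists (exist _ f (ex_intro _ s ers)); apply: freyd_eqv_sub.
- move=> X Y f g [l e] /=; have [m em] := fullF _ _ l; exists m; apply: faithF.
  by rewrite fmap_comp em addF fmap_opp; exact: e.
- move=> Y; have [A [i [j [ij ji]]]] := essF (fr_gen Y).
  have [B [k [l [kl lk]]]] := essF (fr_rel Y).
  have [r er] := fullF _ _ (k ∙ fr_rho Y ∙ j); exists (FreydOb r).
  apply: (@freyd_iso (freyd_map_ob (FreydOb r)) Y i j k l) => //=; rewrite er.
    by rewrite comp_assoc ji comp_idr.
  by rewrite -!comp_assoc lk comp_idl.
Qed.

End FreydMap.

(** * Cokernels of additive and of linear maps *)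

Section Cokernel.
Variables (U V : zmodType) (f : {additive U -> V}).

(** Membership is decided classically, so that the quotient by a decidable subgroup
    applies to the image of any additive map. *)
Definition image_pred : {pred V} := fun y => `[< exists x, f x = y >].

Lemma image_pred_closed : zmod_closed image_pred.
Proof.
split=> [|_ _ /asboolP[x <-] /asboolP[y <-]]; apply/asboolP.
  by exists 0; rewrite raddf0.
by exists (x - y); rewrite raddfB.
Qed.

HB.instance Definition _ := GRing.isZmodClosed.Build V image_pred image_pred_closed.

(** Only surjectivity and the kernel of the projection are retained: the carrier
    stays opaque, which keeps conversion away from the quotient construction. *)
Lemma cokernel_exists : {W : zmodType & {p : {additive V -> W} |
  (forall q, exists y, p y = q) /\ (forall y, p y = 0 <-> exists x, f x = y)}}.
Proof.
exists (Quotient.quot image_pred), (\pi_(Quotient.quot image_pred)%qT); split=> [q|y].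
  by exists (repr q); exact: reprK.
rewrite -(raddf0 \pi_(Quotient.quot image_pred)%qT).
split=> [/eqP|e]; last apply/eqP; rewrite -Quotient.idealrBE subr0.
  by move/asboolP.
exact/asboolP.
Qed.

Definition coker : zmodType := projT1 cokernel_exists.

Definition coker_pi : {additive V -> coker} := sval (projT2 cokernel_exists).

Lemma coker_pi_surj (q : coker) : exists y, coker_pi y = q.
Proof. exact: (svalP (projT2 cokernel_exists)).1 q. Qed.

Lemma coker_pi_eq0 (y : V) : coker_pi y = 0 <-> exists x, f x = y.
Proof. exact: (svalP (projT2 cokernel_exists)).2 y. Qed.

Lemma coker_pi_eq (y z : V) : coker_pi y = coker_pi z <-> exists x, f x = y - z.
Proof.
rewrite -coker_pi_eq0 raddfB; split=> [->|/eqP]; first by rewrite subrr.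
by rewrite subr_eq0 => /eqP.
Qed.

Definition coker_lift (q : coker) : V := sval (cid (coker_pi_surj q)).

Lemma coker_liftK : cancel coker_lift coker_pi.
Proof. by move=> q; exact: svalP (cid (coker_pi_surj q)). Qed.

End Cokernel.

Lemma coker_desc (U V W : zmodType) (f : {additive U -> V}) (g : {additive V -> W}) :
  (forall x, g (f x) = 0) ->
  {h : {additive coker f -> W} | forall y, h (coker_pi f y) = g y}.
Proof.
move=> gf0; pose h (q : coker f) := g (coker_lift q).
have hE y : h (coker_pi f y) = g y.
  have /coker_pi_eq [x e] := coker_liftK (coker_pi f y).
  by apply/eqP; rewrite -subr_eq0 /h -raddfB -e gf0.
have hB : zmod_morphism h.
  move=> p q; have [y <-] := coker_pi_surj p; have [z <-] := coker_pi_surj q.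
  by rewrite -raddfB !hE raddfB.
pose hA : {additive coker f -> W} := HB.pack h (GRing.isZmodMorphism.Build _ _ h hB).
by exists hA.
Qed.

Section LinearCokernel.
Variables (R : pzRingType) (U V : lmodType R) (f : {linear U -> V}).

(** A copy of [coker f], which carries the scalar action induced from [V]. *)
Definition lcoker : Type := coker f.
HB.instance Definition _ := GRing.Zmodule.on lcoker.

Definition lcoker_pi : V -> lcoker := coker_pi f.
HB.instance Definition _ := GRing.isZmodMorphism.Build V lcoker lcoker_pi
  (raddfB (coker_pi f)).

Lemma lcoker_pi_surj (q : lcoker) : exists y, lcoker_pi y = q.
Proof. exact: coker_pi_surj. Qed.

Lemma lcoker_pi_eq (y z : V) : lcoker_pi y = lcoker_pi z <-> exists x, f x = y - z.
Proof. exact: coker_pi_eq. Qed.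

Lemma lcoker_pi_eq0 (y : V) : lcoker_pi y = 0 <-> exists x, f x = y.
Proof. exact: coker_pi_eq0. Qed.

Definition lcoker_scale (a : R) (q : lcoker) : lcoker := lcoker_pi (a *: coker_lift (q : coker f)).

Lemma lcoker_scaleE a y : lcoker_scale a (lcoker_pi y) = lcoker_pi (a *: y).
Proof.
have /lcoker_pi_eq [x e] : lcoker_pi (coker_lift (lcoker_pi y : coker f)) = lcoker_pi y.
  exact: coker_liftK.
by apply/lcoker_pi_eq; exists (a *: x); rewrite linearZ /= e scalerBr.
Qed.

Lemma lcoker_scaleA a b q : lcoker_scale a (lcoker_scale b q) = lcoker_scale (a * b) q.
Proof. by have [y <-] := lcoker_pi_surj q; rewrite !lcoker_scaleE scalerA. Qed.

Lemma lcoker_scale1 : left_id 1 lcoker_scale.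
Proof. by move=> q; have [y <-] := lcoker_pi_surj q; rewrite lcoker_scaleE scale1r. Qed.

Lemma lcoker_scaleDr : right_distributive lcoker_scale +%R.
Proof.
move=> a p q; have [y <-] := lcoker_pi_surj p; have [z <-] := lcoker_pi_surj q.
by rewrite -raddfD !lcoker_scaleE scalerDr raddfD.
Qed.

Lemma lcoker_scaleDl q : {morph lcoker_scale^~ q : a b / a + b}.
Proof.
by move=> a b; have [y <-] := lcoker_pi_surj q; rewrite !lcoker_scaleE scalerDl raddfD.
Qed.

HB.instance Definition _ := GRing.Zmodule_isLmodule.Build R lcoker
  lcoker_scaleA lcoker_scale1 lcoker_scaleDr lcoker_scaleDl.

Lemma lcoker_pi_scalable : scalable lcoker_pi.
Proof. by move=> a y; rewrite -lcoker_scaleE. Qed.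

HB.instance Definition _ := GRing.isScalable.Build R V lcoker *:%R lcoker_pi
  lcoker_pi_scalable.

End LinearCokernel.

Lemma lcoker_desc (R : pzRingType) (U V W : lmodType R)
    (f : {linear U -> V}) (g : {linear V -> W}) :
  (forall x, g (f x) = 0) ->
  {h : {linear lcoker f -> W} | forall y, h (lcoker_pi f y) = g y}.
Proof.
move=> gf0; have [h hE] := @coker_desc _ _ _ f g gf0.
have hL : scalable (h : lcoker f -> W).
  move=> a q; have [y <-] := lcoker_pi_surj q.
  have <- : lcoker_pi f (a *: y) = a *: lcoker_pi f y by rewrite linearZ.
  by rewrite /lcoker_pi !hE /= linearZ.
pose hl : {linear lcoker f -> W} := HB.pack (h : lcoker f -> W)
  (GRing.isZmodMorphism.Build (lcoker f) W h (raddfB h))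
  (GRing.isScalable.Build R (lcoker f) W *:%R h hL).
by exists hl => y; exact: hE.
Qed.

(** * Morphisms between free modules as matrices *)

Section Matrices.
Variable R : comPzRingType.

Definition free_category : ab_category := additive_closure (ring_category R).

Implicit Types s t u : free_category.

(** A morphism of the additive closure is a bare function of two indices;
    these conversions give access to matrix algebra. *)
Definition mx_of s t (a : hom s t) : 'M[R]_(ol_size s, ol_size t) :=
  \matrix_(i, j) (a i j : R).

Definition of_mx s t (M : 'M[R]_(ol_size s, ol_size t)) : hom s t := fun i j => M i j.

Lemma of_mxK s t : cancel (@of_mx s t) (@mx_of s t).
Proof. by move=> M; apply/matrixP => i j; rewrite mxE. Qed.

Lemma mx_of_eqv s t (a b : hom s t) : a ≡ b <-> mx_of a = mx_of b.
Proof.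
split=> [e|/matrixP e] => [|i j]; last by have := e i j; rewrite !mxE.
by apply/matrixP => i j; rewrite !mxE; exact: e.
Qed.

Lemma mx_of_id s : mx_of (idm s) = 1%:M.
Proof.
apply/matrixP => i j; rewrite !mxE; have [<-|ne] := eqVneq i j.
  by rewrite /= id_matrix_diag.
by rewrite /= id_matrix_off.
Qed.

Lemma mx_of_comp s t u (a : hom s t) (b : hom t u) : mx_of (a ∙ b) = mx_of a *m mx_of b.
Proof.
by apply/matrixP => i j; rewrite !mxE; apply: eq_bigr => k _; rewrite !mxE.
Qed.

Lemma mx_of_add s t (a b : hom s t) : mx_of (a ⊞ b) = mx_of a + mx_of b.
Proof. by apply/matrixP => i j; rewrite !mxE. Qed.

Lemma mx_of_opp s t (a : hom s t) : mx_of (hopp a) = - mx_of a.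
Proof. by apply/matrixP => i j; rewrite !mxE. Qed.

Lemma mx_of_zero s t : mx_of (hzero s t) = 0.
Proof. by apply/matrixP => i j; rewrite !mxE. Qed.

Definition free_ob (n : nat) : free_category :=
  @ObjectList (ring_category R) n (fun _ => tt).

(** * Matrices as presentations of modules *)

Definition pres_category : ab_category := freyd_category free_category.

Implicit Types X Y Z : pres_category.

(** The matrix of a morphism on generators. *)
Definition pres X Y (f : hom X Y) := mx_of (sval f).

Lemma pres_homP X Y (f : hom X Y) :
  exists r, mx_of (fr_rho X) *m pres f = r *m mx_of (fr_rho Y).
Proof.
by case: f => f [r e]; exists (mx_of r); rewrite -!mx_of_comp; apply/mx_of_eqv.
Qed.

Lemma pres_hom X Y (M : 'M[R]_(ol_size (fr_gen X), ol_size (fr_gen Y))) :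
  (exists r, mx_of (fr_rho X) *m M = r *m mx_of (fr_rho Y)) ->
  {f : hom X Y | pres f = M}.
Proof.
move=> /cid [r e].
have ex : exists r : hom (fr_rel X) (fr_rel Y), fr_rho X ∙ of_mx M ≡ r ∙ fr_rho Y.
  by exists (of_mx r); apply/mx_of_eqv; rewrite !mx_of_comp !of_mxK.
by exists (exist _ (of_mx M) ex); rewrite /pres of_mxK.
Qed.

Lemma pres_eqv X Y (f g : hom X Y) :
  f ≡ g <-> exists l, l *m mx_of (fr_rho Y) = pres f - pres g.
Proof.
split=> [[l /mx_of_eqv]|[l e]].
  by rewrite mx_of_comp mx_of_add mx_of_opp; exists (mx_of l).
by exists (of_mx l); apply/mx_of_eqv; rewrite mx_of_comp mx_of_add mx_of_opp of_mxK.
Qed.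

Definition pres_module X := lcoker (mulmxr (mx_of (fr_rho X)) :
  {linear 'rV[R]_(ol_size (fr_rel X)) -> 'rV[R]_(ol_size (fr_gen X))}).

Definition pres_pi X : {linear 'rV[R]_(ol_size (fr_gen X)) -> pres_module X} :=
  lcoker_pi _.

Lemma pres_pi_eq X x y :
  pres_pi X x = pres_pi X y <-> exists z, z *m mx_of (fr_rho X) = x - y.
Proof. exact: lcoker_pi_eq. Qed.

Lemma pres_pi_eq0 X x : pres_pi X x = 0 <-> exists z, z *m mx_of (fr_rho X) = x.
Proof. exact: lcoker_pi_eq0. Qed.

Lemma pres_pi_surj X q : exists x, pres_pi X x = q.
Proof. exact: lcoker_pi_surj. Qed.

Lemma pres_moduleP X : finitely_presented (pres_module X).
Proof.
exists _, _, (mulmxr (mx_of (fr_rho X))), (pres_pi X).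
by split=> [y|x]; [exact: pres_pi_surj|exact: pres_pi_eq0].
Qed.

Definition pres_ob X : fpmod_category R := FpMod (pres_moduleP X).

Lemma pres_map_subproof X Y (f : hom X Y) :
  {h : {linear pres_module X -> pres_module Y} |
    forall x, h (pres_pi X x) = pres_pi Y (x *m pres f)}.
Proof.
apply: (@lcoker_desc _ _ _ _ _ (pres_pi Y \o mulmxr (pres f))) => x /=.
have [r e] := pres_homP f.
by apply/pres_pi_eq0; exists (x *m r); rewrite -!mulmxA e.
Qed.

Definition pres_map X Y (f : hom X Y) : {linear pres_module X -> pres_module Y} :=
  sval (pres_map_subproof f).

Lemma pres_mapE X Y (f : hom X Y) x :
  pres_map f (pres_pi X x) = pres_pi Y (x *m pres f).
Proof. exact: svalP (pres_map_subproof f) x. Qed.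

Lemma pres_map_eqv X Y (f g : hom X Y) : f ≡ g -> pres_map f =1 pres_map g.
Proof.
move=> /pres_eqv [l e] q; have [x <-] := pres_pi_surj q.
rewrite !pres_mapE; apply/pres_pi_eq; exists (x *m l).
by rewrite -mulmxA e mulmxBr.
Qed.

Lemma pres_map_id X : pres_map (idm X) =1 id.
Proof.
move=> q; have [x <-] := pres_pi_surj q.
by rewrite pres_mapE /pres mx_of_id mulmx1.
Qed.

Lemma pres_map_comp X Y Z (f : hom X Y) (g : hom Y Z) :
  pres_map (f ∙ g) =1 pres_map g \o pres_map f.
Proof.
move=> q; have [x <-] := pres_pi_surj q.
by rewrite -[RHS]/(pres_map g (pres_map f _)) !pres_mapE /pres mx_of_comp mulmxA.
Qed.

Lemma pres_map_add X Y (f g : hom X Y) : pres_map (f ⊞ g) =1 pres_map f \+ pres_map g.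
Proof.
move=> q; have [x <-] := pres_pi_surj q.
by rewrite /= !pres_mapE /pres mx_of_add mulmxDr raddfD.
Qed.

Definition pres_functor : functor pres_category (fpmod_category R).
Proof.
exists pres_ob (fun X Y f => pres_map f : @hom (fpmod_category R) (pres_ob X) (pres_ob Y)).
- exact: pres_map_eqv.
- exact: pres_map_id.
- exact: pres_map_comp.
Defined.

Lemma pres_functor_additive : additive_functor pres_functor.
Proof. exact: pres_map_add. Qed.

(** The rows of a matrix are chosen one generator at a time: preimages of the
    images of the generators for fullness, coefficients that express each row of the
    difference by relations for faithfulness. A finite presentation of a module is
    literally an object with an isomorphic cokernel. *)
Lemma pres_functor_weak_equivalence : weak_equivalence pres_functor.
Proof.
split.
- move=> X Y h.
  have /choice [m em] i := pres_pi_surj (h (pres_pi X (delta_mx 0 i))).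
  pose M := \matrix_i m i.
  have hE x : h (pres_pi X x) = pres_pi Y (x *m M).
    rewrite mulmx_sum_row {1}[x]row_sum_delta !raddf_sum /=.
    by apply: eq_bigr => i _; rewrite !linearZ /= -em rowK.
  (* [M] respects relations since [h] kills the classes of the rows of [fr_rho X]. *)
  have /choice [r er] i : exists z, z *m mx_of (fr_rho Y) = row i (mx_of (fr_rho X) *m M).
    apply/pres_pi_eq0; rewrite row_mul -hE (_ : pres_pi X _ = 0) ?raddf0 //.
    by apply/pres_pi_eq0; exists (delta_mx 0 i); rewrite -rowE.
  have [|f ef] := @pres_hom X Y M.
    exists (\matrix_i r i); apply/row_matrixP => i.
    by rewrite [in RHS]row_mul rowK er.
  exists f => q; have [x <-] := pres_pi_surj q.
  by rewrite /= pres_mapE ef -hE.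
- move=> X Y f g e; apply/pres_eqv.
  have /choice [l el] i : exists z, z *m mx_of (fr_rho Y) = row i (pres f - pres g).
    have := e (pres_pi X (delta_mx 0 i)); rewrite /= !pres_mapE.
    by move/pres_pi_eq; rewrite -mulmxBr -rowE.
  by exists (\matrix_i l i); apply/row_matrixP => i; rewrite row_mul rowK el.
- move=> M; have [m [n [f [p [p_surj p_ker]]]]] := fp_moduleP M.
  pose X : pres_category := FreydOb (@of_mx (free_ob m) (free_ob n) (lin1_mx f)).
  have fE z : z *m mx_of (fr_rho X) = f z by rewrite of_mxK mul_rV_lin1.
  have [h hE] : {h : {linear pres_module X -> M} | forall x, h (pres_pi X x) = p x}.
    apply: (lcoker_desc (f := mulmxr (mx_of (fr_rho X)))) => z /=.
    by apply/p_ker; exists z; rewrite fE.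
  have h_inj : injective h.
    move=> q q'; have [x <-] := pres_pi_surj q; have [y <-] := pres_pi_surj q'.
    rewrite !hE => /eqP; rewrite -subr_eq0 -raddfB => /eqP/p_ker [z ez].
    by apply/pres_pi_eq; exists z; rewrite fE.
  have /choice [k hk] y : exists q, h q = y.
    by have [x <-] := p_surj y; exists (pres_pi X x); exact: hE.
  have kh : cancel h k by move=> q; apply: h_inj; rewrite hk.
  have k_lin : linear k by move=> a x y; apply: h_inj; rewrite linearP !hk.
  pose kl : {linear M -> pres_module X} := HB.pack k (GRing.isLinear.Build _ _ _ _ k k_lin).
  by exists X, (h : {linear pres_ob X -> M}), kl; split.
Qed.

End Matrices.

(** * Finitely presented functors *)

Lemma is_cokernel_isomorphic (C : ab_category) (A B Q Q' : C) (f f' : hom A B)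
    (q : hom B Q) (q' : hom B Q') :
  f ≡ f' -> is_cokernel f q -> is_cokernel f' q' -> isomorphic Q Q'.
Proof.
move=> ef [fq univ] [fq' univ'].
have [u qu _] : exists2 u, q ∙ u ≡ q' & forall u', q ∙ u' ≡ q' -> u' ≡ u.
  by apply: univ; rewrite ef.
have [v qv _] : exists2 v, q' ∙ v ≡ q & forall v', q' ∙ v' ≡ q -> v' ≡ v.
  by apply: univ'; rewrite -ef.
exists u, v; split.
  have [w _ uniq_w] := univ _ _ fq; transitivity w.
    by apply: uniq_w; rewrite -comp_assoc qu qv.
  by symmetry; apply: uniq_w; exact: comp_idr.
have [w _ uniq_w] := univ' _ _ fq'; transitivity w.
  by apply: uniq_w; rewrite -comp_assoc qv qu.
by symmetry; apply: uniq_w; exact: comp_idr.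
Qed.

Section PreComposition.
Variables (R : comPzRingType) (A B M : lmodType R) (f : {linear A -> B}).

Definition linear_precomp (g : {linear B -> M}) : {linear A -> M} := g \o f.

Lemma linear_precomp_sub : zmod_morphism linear_precomp.
Proof. by move=> g h; apply: linear_inj. Qed.

HB.instance Definition _ := GRing.isZmodMorphism.Build
  {linear B -> M} {linear A -> M} linear_precomp linear_precomp_sub.

End PreComposition.

(** An object of the Freyd category of the opposite of finitely presented modules is
    a linear map from [copres_gen X] to [copres_rel X]. *)
Section CokernelFunctor.
Variable R : comPzRingType.

Local Notation copres := (freyd_category (op_ab (fpmod_category R))).
Implicit Types (X Y Z : copres) (M N : fpmod R).

Definition copres_gen X : fpmod R := fr_gen X.
Definition copres_rel X : fpmod R := fr_rel X.
Definition copres_rho X : {linear copres_gen X -> copres_rel X} := fr_rho X.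

(** The value at [M] of the functor with copresentation [X]: linear maps from the
    source of [copres_rho X] to [M], modulo those that extend along it. *)
Definition value X M : zmodType :=
  coker (linear_precomp (M := M) (copres_rho X) : {additive _ -> _}).

Definition value_pi X M : {additive {linear copres_gen X -> M} -> value X M} :=
  coker_pi _.

Arguments value_pi : simpl never.

Lemma value_pi_ext X M (g h : {linear copres_gen X -> M}) :
  g =1 h -> value_pi X M g = value_pi X M h.
Proof. by move=> /linear_inj ->. Qed.

Lemma value_pi_surj X M q : exists g, value_pi X M g = q.
Proof. exact: coker_pi_surj. Qed.

Lemma value_pi_eq X M (g h : {linear copres_gen X -> M}) :
  value_pi X M g = value_pi X M h <->
  exists l : {linear copres_rel X -> M}, forall x, l (copres_rho X x) = g x - h x.
Proof.
rewrite coker_pi_eq; split=> -[l e]; exists l.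
  by move=> x; rewrite -[LHS]/(linear_precomp (copres_rho X) l x) e.
exact: linear_inj.
Qed.

Lemma value_pi_eq0 X M (g : {linear copres_gen X -> M}) :
  value_pi X M g = 0 <->
  exists l : {linear copres_rel X -> M}, forall x, l (copres_rho X x) = g x.
Proof.
rewrite -(raddf0 (value_pi X M)) value_pi_eq.
by split=> -[l e]; exists l => x; rewrite e subr0.
Qed.

Lemma value_map_subproof X M N (f : {linear M -> N}) :
  {h : {additive value X M -> value X N} |
    forall g, h (value_pi X M g) = value_pi X N (linear_postcomp f g)}.
Proof.
apply: (coker_desc (g := value_pi X N \o linear_postcomp f)) => l /=.
by apply/value_pi_eq0; exists (linear_postcomp f l).
Qed.

Definition value_map X M N (f : {linear M -> N}) := sval (value_map_subproof X f).

Lemma value_mapE X M N (f : {linear M -> N}) g :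
  value_map X f (value_pi X M g) = value_pi X N (linear_postcomp f g).
Proof. exact: svalP (value_map_subproof X f) g. Qed.

Definition value_functor X : functor (fpmod_category R) Ab.
Proof.
exists (fun M => value X M : Ab) (fun M N f => value_map X f : {additive _ -> _}).
- move=> M N f g e q; have [h <-] := value_pi_surj q.
  by rewrite !value_mapE; apply: value_pi_ext => x; exact: e.
- move=> M q; have [h <-] := value_pi_surj q.
  by rewrite value_mapE; exact: value_pi_ext.
- move=> M N P f g q; have [h <-] := value_pi_surj q.
  by rewrite /= !value_mapE; exact: value_pi_ext.
Defined.

Lemma value_functor_additive X : additive_functor (value_functor X).
Proof.
move=> M N f g q; have [h <-] := value_pi_surj q.
rewrite /= !value_mapE -raddfD; exact: value_pi_ext.
Qed.

Definition value_additive X : additive_functors (fpmod_category R) Ab :=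
  exist _ (value_functor X) (@value_functor_additive X).

Definition precomp_natural (A B : fpmod R) (f : {linear A -> B}) :
  hom (representable B) (representable A).
Proof.
exists (fun M : fpmod_category R => linear_precomp (M := M) f : {additive _ -> _}).
by move=> M N g h; exact: linear_inj.
Defined.

Definition value_projection X : hom (representable (copres_gen X)) (value_additive X).
Proof.
exists (fun M : fpmod_category R => value_pi X M : {additive _ -> _}).
by move=> M N f g; rewrite /= value_mapE.
Defined.

(** Cokernels of natural transformations are computed pointwise: a map out of
    each value is induced by [t], and its naturality can be tested on classes of
    linear maps. *)
Lemma value_cokernel X :
  is_cokernel (precomp_natural (copres_rho X)) (value_projection X).
Proof.
split=> [M l|T t zt].
  by apply/value_pi_eq0; exists l.
have uP M : {h : {additive value X M -> (sval T M : zmodType)} |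
    forall g, h (value_pi X M g) = nt t M g}.
  by apply: (coker_desc (g := nt t M)) => l; exact: zt.
unshelve eexists.
- exists (fun M : fpmod_category R => sval (uP M) : {additive _ -> _}).
  move=> M N f q; have [g <-] := value_pi_surj q.
  rewrite /= value_mapE !(svalP (uP _)); exact: (ntE t f g).
- by move=> M g; rewrite /= (svalP (uP M)).
- move=> u' eu M q; have [g <-] := value_pi_surj q.
  by rewrite /= (svalP (uP M)); exact: eu.
Qed.

(** Morphisms run against the underlying linear maps because of the opposite. *)
Definition copres_hom X Y (a : hom X Y) : {linear copres_gen Y -> copres_gen X} :=
  freyd_val a.

Lemma fpmod_compE (A B D : fpmod_category R) (f : hom A B) (g : hom B D) :
  f ∙ g = g \o f :> {linear A -> D}.
Proof. by []. Qed.

Lemma copres_hom_comp X Y Z (a : hom X Y) (b : hom Y Z) :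
  copres_hom (a ∙ b) = copres_hom a \o copres_hom b :> {linear _ -> _}.
Proof. rewrite /copres_hom freyd_val_comp op_compE; exact: fpmod_compE. Qed.

Lemma cokernel_map_subproof X Y (a : hom X Y) M :
  {h : {additive value X M -> value Y M} |
    forall g, h (value_pi X M g) = value_pi Y M (linear_precomp (copres_hom a) g)}.
Proof.
apply: (coker_desc (g := value_pi Y M \o linear_precomp (copres_hom a))) => l /=.
apply/value_pi_eq0; case: a => a [r e]; exists (linear_precomp (r : {linear _ -> _}) l) => x.
by rewrite /=; congr (l _); symmetry; exact: e.
Qed.

Definition cokernel_map X Y (a : hom X Y) M : {additive value X M -> value Y M} :=
  sval (cokernel_map_subproof a M).

Lemma cokernel_mapE X Y (a : hom X Y) M g :
  cokernel_map a M (value_pi X M g) = value_pi Y M (linear_precomp (copres_hom a) g).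
Proof. exact: svalP (cokernel_map_subproof a M) g. Qed.

Definition cokernel_natural X Y (a : hom X Y) : natural (value_functor X) (value_functor Y).
Proof.
exists (fun M : fpmod_category R => cokernel_map a M : {additive _ -> _}).
move=> M N f q; have [g <-] := value_pi_surj q.
by rewrite /= !value_mapE !cokernel_mapE value_mapE; exact: value_pi_ext.
Defined.

Definition cokernel_functor : functor copres (functor_ab (fpmod_category R) Ab).
Proof.
exists value_functor cokernel_natural.
- move=> X Y a b [l e] M q; have [g <-] := value_pi_surj q.
  rewrite [LHS]cokernel_mapE [RHS]cokernel_mapE; apply/value_pi_eq.
  exists (linear_postcomp g (l : {linear _ -> _})) => x.
  by rewrite /= -raddfB; congr (g _); exact: e.
- move=> X M q; have [g <-] := value_pi_surj q.
  by rewrite [LHS]cokernel_mapE; exact: value_pi_ext.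
- move=> X Y Z a b M q; have [g <-] := value_pi_surj q.
  rewrite [LHS]cokernel_mapE -[RHS]/(cokernel_map b M (cokernel_map a M _)).
  by rewrite 2!cokernel_mapE copres_hom_comp; exact: value_pi_ext.
Defined.

(** Yoneda: [s] is determined by its value at the class of the identity of
    [copres_gen X]. A linear map [a] representing that value induces [s], and [a] is
    compatible with relations because the class of [copres_rho X] at [copres_rel X]
    is zero. *)
Lemma cokernel_functor_full : full cokernel_functor.
Proof.
move=> X Y s; pose t M : {additive value X M -> value Y M} := nt s M.
pose idX : {linear copres_gen X -> copres_gen X} := idfun.
have [a ea] := value_pi_surj (t (copres_gen X) (value_pi X _ idX)).
have tE M (g : {linear copres_gen X -> M}) :
    t M (value_pi X M g) = value_pi Y M (linear_postcomp g a).
  have := ntE s (g : @hom (fpmod_category R) _ _) (value_pi X _ idX).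
  rewrite -[LHS]/(t M (value_map X g (value_pi X _ idX))).
  rewrite -[RHS]/(value_map Y g (t _ (value_pi X _ idX))) -ea !value_mapE => <-.
  by congr (t M _); exact: value_pi_ext.
have /value_pi_eq0 [r er] :
    value_pi Y (copres_rel X) (linear_postcomp (copres_rho X) a) = 0.
  rewrite -tE (_ : value_pi X _ _ = 0) ?raddf0 //.
  by apply/value_pi_eq0; exists idfun.
have ex : exists r : @hom (op_ab (fpmod_category R)) (fr_rel X) (fr_rel Y),
    @eqv (op_ab (fpmod_category R)) _ _ (fr_rho X ∙ a) (r ∙ fr_rho Y).
  by exists r => x; symmetry; exact: er.
pose b : hom X Y := exist _ a ex.
exists b => M q; have [g <-] := @value_pi_surj X M q.
transitivity (cokernel_map b M (value_pi X M g)); first reflexivity.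
rewrite cokernel_mapE; symmetry; exact (tE M g).
Qed.

(** Evaluated at the class of the identity, equality of the induced transformations
    is precisely the homotopy that makes two morphisms equal in the Freyd
    category. *)
Lemma cokernel_functor_faithful : faithful cokernel_functor.
Proof.
move=> X Y a b e; have := e (copres_gen X) (value_pi X _ idfun).
rewrite [LHS]cokernel_mapE [RHS]cokernel_mapE => /value_pi_eq [l el].
by exists l => x; exact: el.
Qed.

Definition additive_cokernel_functor :
  functor copres (additive_functors (fpmod_category R) Ab) :=
  corestrict (F := cokernel_functor) value_functor_additive.

Lemma value_fp_functor X : fp_functor (additive_cokernel_functor X).
Proof.
exists (copres_gen X), (copres_rel X), (precomp_natural (copres_rho X)).
by exists (value_projection X); exact: value_cokernel.
Qed.

Definition fp_cokernel_functor : functor copres (fp_functors R) :=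
  corestrict value_fp_functor.

(** By Yoneda a presentation of a functor is precomposition with a linear map
    [rho], hence an object of the Freyd category; uniqueness of cokernels identifies
    the given functor with the pointwise cokernel. *)
Lemma fp_cokernel_functor_weak_equivalence : weak_equivalence fp_cokernel_functor.
Proof.
split.
- exact/corestrict_full/corestrict_full/cokernel_functor_full.
- exact/corestrict_faithful/corestrict_faithful/cokernel_functor_faithful.
- apply: corestrict_ess_surj => F [A [B [eta [pi F_coker]]]].
  pose rho : {linear A -> B} := nt eta B idfun.
  have etaE : eta ≡ precomp_natural rho.
    move=> M g; have := ntE eta (g : @hom (fpmod_category R) B M) idfun.
    rewrite /= => e; rewrite [RHS](_ : _ = linear_postcomp g (nt eta B idfun)); last first.
      exact: linear_inj.
    by rewrite -e; congr (nt eta M _); exact: linear_inj.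
  pose X : copres := @FreydOb (op_ab (fpmod_category R)) A B rho.
  exists X; apply: is_cokernel_isomorphic (value_cokernel X) F_coker.
  by move=> M g; rewrite (etaE M g).
Qed.

End CokernelFunctor.

(** * Linear categories with finitely presented hom-modules *)

Section LinearCategories.
Variable R : comPzRingType.

(** An R-linear structure, encoded as a ring morphism from R to the centre of the
    category (natural endomorphisms of the identity functor). It acts on a morphism by
    composition, so compatibility with composition is automatic, and
    the same endomorphisms act on opposite and Freyd categories. *)
Record linear_structure (C : ab_category) := LinearStructure {
  scal :> R -> forall X : C, hom X X;
  scal_natural : forall a (X Y : C) (f : hom X Y), scal a X ∙ f ≡ f ∙ scal a Y;
  scal_one : forall X : C, scal 1 X ≡ idm X;
  scal_add : forall a b (X : C), scal (a + b) X ≡ scal a X ⊞ scal b X;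
  scal_mul : forall a b (X : C), scal (a * b) X ≡ scal a X ∙ scal b X
}.

Definition free_linear : linear_structure (free_category R).
Proof.
exists (fun a s => of_mx a%:M).
- by move=> a s t f; apply/mx_of_eqv; rewrite !mx_of_comp !of_mxK scalar_mxC.
- by move=> s; apply/mx_of_eqv; rewrite of_mxK mx_of_id.
- by move=> a b s; apply/mx_of_eqv; rewrite mx_of_add !of_mxK raddfD.
- by move=> a b s; apply/mx_of_eqv; rewrite mx_of_comp !of_mxK scalar_mxM.
Defined.

Definition op_linear (C : ab_category) (z : linear_structure C) :
  linear_structure (op_ab C).
Proof.
exists (fun a (X : op_ab C) => z a X : @hom (op_ab C) X X).
- by move=> a X Y f; rewrite /= -scal_natural.
- exact: scal_one z.
- exact: scal_add z.
- by move=> a b X; rewrite /= mulrC scal_mul.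
Defined.

Definition freyd_linear (C : ab_category) (z : linear_structure C) :
  linear_structure (freyd_category C).
Proof.
unshelve eexists.
- move=> a X; exists (z a (fr_gen X)); exists (z a (fr_rel X)).
  by rewrite scal_natural.
- by move=> a X Y f; apply: freyd_eqv_sub; exact: scal_natural.
- by move=> X; apply: freyd_eqv_sub; exact: scal_one.
- by move=> a b X; apply: freyd_eqv_sub; exact: scal_add.
- by move=> a b X; apply: freyd_eqv_sub; exact: scal_mul.
Defined.

(** An exact sequence R^rels -> R^gens -> Hom(X, Y) -> 0, with exactness
    up to equality of morphisms. *)
Record presentation (C : ab_category) (z : linear_structure C) (X Y : C) := Presentation {
  pr_gens : nat;
  pr_rels : nat;
  pr_rel : 'M[R]_(pr_rels, pr_gens);
  pr_val : 'rV[R]_pr_gens -> hom X Y;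
  pr_add : forall x y, pr_val (x + y) ≡ pr_val x ⊞ pr_val y;
  pr_scale : forall a x, pr_val (a *: x) ≡ z a X ∙ pr_val x;
  pr_surj : forall f, exists x, pr_val x ≡ f;
  pr_ker : forall x, pr_val x ≡ hzero X Y <-> exists y, x = y *m pr_rel
}.

Arguments pr_val {C z X Y} p x.
Arguments pr_surj {C z X Y} p f.

Definition fp_homs (C : ab_category) (z : linear_structure C) : Type :=
  forall X Y : C, presentation z X Y.

Definition free_fp_homs : fp_homs free_linear.
Proof.
move=> s t.
exists _ 0%N 0 (fun x => of_mx (vec_mx x) : @hom (free_category R) s t).
- by move=> x y; apply/mx_of_eqv; rewrite mx_of_add !of_mxK raddfD.
- by move=> a x; apply/mx_of_eqv; rewrite mx_of_comp !of_mxK linearZ mul_scalar_mx.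
- by move=> f; exists (mxvec (mx_of f)); apply/mx_of_eqv; rewrite of_mxK mxvecK.
- move=> x; split=> [/mx_of_eqv|[y ->]].
    rewrite of_mxK mx_of_zero => e; exists 0; rewrite mulmx0.
    by rewrite -[x]vec_mxK e raddf0.
  by apply/mx_of_eqv; rewrite of_mxK mx_of_zero mulmx0 raddf0.
Defined.

Definition op_fp_homs (C : ab_category) (z : linear_structure C) :
  fp_homs z -> fp_homs (op_linear z).
Proof.
move=> P X Y; have [k l M v vD vZ vS vK] := P Y X.
exists k l M (v : _ -> @hom (op_ab C) X Y) => //.
by move=> a x; rewrite /= vZ scal_natural.
Defined.

Section PresentationTheory.
Variables (C : ab_category) (z : linear_structure C).

Lemma row_ext (n : nat) (X Y : C) (p q : 'rV[R]_n -> hom X Y) :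
  (forall x y, p (x + y) ≡ p x ⊞ p y) -> (forall a x, p (a *: x) ≡ z a X ∙ p x) ->
  (forall x y, q (x + y) ≡ q x ⊞ q y) -> (forall a x, q (a *: x) ≡ z a X ∙ q x) ->
  (forall i, p (delta_mx 0 i) ≡ q (delta_mx 0 i)) -> forall x, p x ≡ q x.
Proof.
move=> pD pZ qD qZ e x.
have zero (r : 'rV[R]_n -> hom X Y) : (forall x y, r (x + y) ≡ r x ⊞ r y) -> r 0 ≡ hzero X Y.
  by move=> rD; apply: (@hadd_cancel _ _ _ (r 0)); rewrite -rD hadd_zeror addr0.
rewrite [x]row_sum_delta; elim/big_ind: _ => [|y y' ey ey'|i _].
- by rewrite !zero.
- by rewrite pD qD ey ey'.
- by rewrite pZ qZ e.
Qed.

Variables (X Y : C) (P : presentation z X Y).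

Lemma pr_eq x y : pr_val P x ≡ pr_val P y <-> exists w, x = y + w *m pr_rel P.
Proof.
have e : pr_val P x ≡ pr_val P y ⊞ pr_val P (x - y) by rewrite -pr_add addrC subrK.
split=> [exy|[w ->]].
  have /pr_ker [w ew] : pr_val P (x - y) ≡ hzero X Y.
    by apply: (@hadd_cancel _ _ _ (pr_val P y)); rewrite -e hadd_zeror.
  by exists w; rewrite -ew addrC subrK.
rewrite pr_add (_ : pr_val P (w *m _) ≡ hzero X Y) ?hadd_zeror //.
by apply/pr_ker; exists w.
Qed.

(** Free modules are projective: the linear map h |-> f . h . g lifts to
    generators, and the lift is determined row by row. *)
Lemma pr_lift (X' Y' : C) (Q : presentation z X' Y') (f : hom X' X) (g : hom Y Y') :
  {M | forall x, pr_val Q (x *m M) ≡ f ∙ pr_val P x ∙ g}.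
Proof.
apply: cid.
have /choice [m em] i := pr_surj Q (f ∙ pr_val P (delta_mx 0 i) ∙ g).
exists (\matrix_i m i); apply: row_ext => [x y|a x|x y|a x|i].
- by rewrite mulmxDl pr_add.
- by rewrite -scalemxAl pr_scale.
- by rewrite pr_add comp_addr comp_addl.
- by rewrite pr_scale -!comp_assoc scal_natural.
- by rewrite -rowE rowK em.
Qed.

End PresentationTheory.

(** * Coherence *)

Section Coherence.
Hypothesis R_coherent : coherent R.

(** The pairs (x, y) with x A = y B form the kernel of a map between free
    modules, finitely generated by coherence; so is its projection to x. *)
Lemma projection_fg (m n p : nat) (A : 'M[R]_(m, n)) (B : 'M[R]_(p, n)) :
  {k & {K : 'M[R]_(k, m) |
    forall x : 'rV_m, (exists y, x *m A = y *m B) <-> exists w, x = w *m K}}.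
Proof.
have free l : fg_free ('rV[R]_l) by exists l, idfun; exists idfun.
have [k /cid [g gP]] := cid (R_coherent (mulmxr (col_mx A (- B))) (free (m + p)%N) (free n)).
exists k, (\matrix_i lsubmx (g i)) => x; split.
- case=> y e; have /gP [c ec] : mulmxr (col_mx A (- B)) (row_mx x y) = 0.
    by rewrite /= mul_row_col mulmxN e subrr.
  exists (\row_i c i); rewrite -[x](row_mxKl x y) ec raddf_sum mulmx_sum_row.
  by apply: eq_bigr => i _; rewrite /= linearZ /= rowK mxE.
- case=> w ->; pose u := \sum_i w 0 i *: g i.
  have /gP e : exists c : 'I_k -> R, u = \sum_i c i *: g i by exists (w 0).
  exists (rsubmx u); apply/eqP; rewrite -subr_eq0 -mulmxN.
  rewrite (_ : w *m _ = lsubmx u) -?mul_row_col ?hsubmxK; first exact/eqP.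
  rewrite raddf_sum mulmx_sum_row.
  by apply: eq_bigr => i _; rewrite /= linearZ /= rowK.
Qed.

Section FreydPresentation.
Variables (C : ab_category) (z : linear_structure C) (P : fp_homs z).
Variables X Y : freyd_category C.

Let gg := P (fr_gen X) (fr_gen Y).
Let rr := P (fr_rel X) (fr_rel Y).
Let rg := P (fr_rel X) (fr_gen Y).
Let gr := P (fr_gen X) (fr_rel Y).

(** Coefficients of morphisms of generators that admit a witness on relations. With
    the witness written in coefficients as well, the condition becomes a linear system
    in [x], the coefficients of the witness and those of a relation in
    Hom(rel X, gen Y). *)
Lemma freyd_hom_fg : {k & {K : 'M[R]_(k, pr_gens gg) | forall x,
  (exists r, fr_rho X ∙ pr_val gg x ≡ r ∙ fr_rho Y) <-> exists w, x = w *m K}}.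
Proof.
have [A eA] := pr_lift gg rg (fr_rho X) (idm _).
have [B eB] := pr_lift rr rg (idm _) (fr_rho Y).
have [k [K eK]] := projection_fg A (col_mx B (pr_rel rg)).
exists k, K => x; rewrite -eK {eK}; split.
- case=> r er; have [y ey] := pr_surj rr r.
  have /pr_eq [w ->] : pr_val rg (x *m A) ≡ pr_val rg (y *m B).
    by rewrite eA eB comp_idl comp_idr ey.
  by exists (row_mx y w); rewrite mul_row_col.
- case=> yw; rewrite -[yw]hsubmxK mul_row_col => e.
  exists (pr_val rr (lsubmx yw)).
  rewrite -[_ ∙ _]comp_idr -eA -[pr_val rr _]comp_idl -eB.
  by apply/pr_eq; exists (rsubmx yw).
Qed.

(** The same reduction for the morphisms that vanish in the Freyd category, with
    the homotopy in place of the witness. *)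
Lemma freyd_null_fg (k : nat) (K : 'M[R]_(k, pr_gens gg)) :
  {l & {L : 'M[R]_(l, k) | forall x,
    (exists r, r ∙ fr_rho Y ≡ pr_val gg (x *m K)) <-> exists w, x = w *m L}}.
Proof.
have [A eA] := pr_lift gr gg (idm _) (fr_rho Y).
have [l [L eL]] := projection_fg K (col_mx A (pr_rel gg)).
exists l, L => x; rewrite -eL {eL}; split.
- case=> r er; have [y ey] := pr_surj gr r.
  have /pr_eq [w ->] : pr_val gg (x *m K) ≡ pr_val gg (y *m A).
    by rewrite eA comp_idl ey er.
  by exists (row_mx y w); rewrite mul_row_col.
- case=> yw; rewrite -[yw]hsubmxK mul_row_col => e.
  exists (pr_val gr (lsubmx yw)).
  rewrite -[pr_val gr _]comp_idl -eA; symmetry.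
  by apply/pr_eq; exists (rsubmx yw).
Qed.

(** Generators are those of [freyd_hom_fg]; the relations between them are found by
    pulling back [freyd_null_fg]. *)
Lemma freyd_presentation : presentation (freyd_linear z) X Y.
Proof.
have [k [K eK]] := freyd_hom_fg; have [l [L eL]] := freyd_null_fg K.
have val_ex x : exists r, fr_rho X ∙ pr_val gg (x *m K) ≡ r ∙ fr_rho Y.
  by apply/eK; exists x.
exists k l L (fun x => exist _ (pr_val gg (x *m K)) (val_ex x) : hom X Y).
- by move=> x y; apply: freyd_eqv_sub; rewrite /= mulmxDl pr_add.
- by move=> a x; apply: freyd_eqv_sub; rewrite /= -scalemxAl pr_scale.
- case=> f fr; have [x ex] := pr_surj gg f.
  have /eK [w ew] : exists r, fr_rho X ∙ pr_val gg x ≡ r ∙ fr_rho Y.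
    by case: fr => r er; exists r; rewrite ex.
  by exists w; apply: freyd_eqv_sub; rewrite /= -ew.
- move=> x; rewrite -eL; split=> -[r er]; exists r.
    by move/hsubP: er => /= ->; rewrite hadd_zerol.
  by apply/hsubP; rewrite /= hadd_zerol er.
Qed.

End FreydPresentation.

Definition freyd_fp_homs (C : ab_category) (z : linear_structure C) :
  fp_homs z -> fp_homs (freyd_linear z) :=
  fun P X Y => freyd_presentation P X Y.

End Coherence.

(** * The homomorphism structure *)

Section HomStructure.
Variables (C : ab_category) (z : linear_structure C) (P : fp_homs z).

Local Notation pres_cat := (pres_category R).
Local Notation val := (pr_val (P _ _)).

Definition hom_ob (X Y : C) : pres_cat :=
  FreydOb (@of_mx R (free_ob R _) (free_ob R _) (pr_rel (P X Y))).

(** The ring itself: one generator and no relations. *)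
Definition unit_ob : pres_cat := FreydOb (@of_mx R (free_ob R 0) (free_ob R 1) 0).

(** Maps out of a presented module are determined by their effect on elements. All
    identities required of the bifunctor are reduced to Hom-sets through this
    lemma and [hom_mapE]. *)
Lemma hom_ob_eqv (X Y X' Y' : C) (u v : hom (hom_ob X Y) (hom_ob X' Y')) :
  (forall x : 'rV_(pr_gens (P X Y)),
    pr_val (P X' Y') (x *m pres u) ≡ pr_val (P X' Y') (x *m pres v)) -> u ≡ v.
Proof.
move=> e; apply/pres_eqv; rewrite of_mxK.
have /choice [l el] i : exists w, w *m pr_rel (P X' Y') = row i (pres u - pres v).
  have /pr_eq [w ew] := e (delta_mx 0 i).
  by exists w; rewrite rowE mulmxBr ew addrC addKr.
by exists (\matrix_i l i); apply/row_matrixP => i; rewrite row_mul rowK el.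
Qed.

Lemma hom_map_subproof (X Y X' Y' : C) (f : hom X' X) (g : hom Y Y') :
  {u : hom (hom_ob X Y) (hom_ob X' Y') | forall x : 'rV_(pr_gens (P X Y)),
    pr_val (P X' Y') (x *m pres u) ≡ f ∙ pr_val (P X Y) x ∙ g}.
Proof.
have [M eM] := pr_lift (P X Y) (P X' Y') f g.
have [|u eu] := @pres_hom R (hom_ob X Y) (hom_ob X' Y') M.
  rewrite !of_mxK.
  have /choice [l el] i : exists w, row i (pr_rel (P X Y) *m M) = w *m pr_rel (P X' Y').
    apply/pr_ker; rewrite row_mul eM (_ : pr_val _ _ ≡ hzero X Y) ?comp_zeror ?comp_zerol //.
    by apply/pr_ker; exists (delta_mx 0 i); rewrite -rowE.
  by exists (\matrix_i l i); apply/row_matrixP => i; rewrite el row_mul rowK.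
by exists u => x; rewrite eu.
Qed.

Definition hom_map (X Y X' Y' : C) (f : hom X' X) (g : hom Y Y') :
  hom (hom_ob X Y) (hom_ob X' Y') := sval (hom_map_subproof f g).

Lemma hom_mapE (X Y X' Y' : C) (f : hom X' X) (g : hom Y Y') (x : 'rV_(pr_gens (P X Y))) :
  pr_val (P X' Y') (x *m pres (hom_map f g)) ≡ f ∙ pr_val (P X Y) x ∙ g.
Proof. exact: svalP (hom_map_subproof f g) x. Qed.

Definition hom_bifunctor : functor (prod_cat (op_cat C) C) pres_cat.
Proof.
exists (fun XY => hom_ob XY.1 XY.2)
  (fun XY XY' (fg : @hom (prod_cat (op_cat C) C) XY XY') => hom_map fg.1 fg.2).
- by move=> XY XY' fg fg' [e1 e2]; apply: hom_ob_eqv => x; rewrite !hom_mapE e1 e2.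
- move=> XY; apply: hom_ob_eqv => x.
  by rewrite hom_mapE /pres mx_of_id mulmx1 comp_idl comp_idr.
- move=> XY XY' XY'' fg fg'; apply: hom_ob_eqv => x.
  rewrite hom_mapE /pres mx_of_comp mulmxA -!/(pres _) !hom_mapE /=.
  by rewrite !comp_assoc.
Defined.

(** The inverse of [hs_nu]: the matrix of a morphism out of [unit_ob] is a row of
    coefficients, hence names an element of Hom(X, Y). *)
Definition unit_val (X Y : C) (u : hom unit_ob (hom_ob X Y)) : hom X Y :=
  pr_val (P X Y) (pres u).

Lemma unit_val_eqv (X Y : C) (u v : hom unit_ob (hom_ob X Y)) :
  unit_val u ≡ unit_val v <-> u ≡ v.
Proof.
rewrite pres_eqv of_mxK pr_eq; split=> -[w e]; exists w.
  by rewrite e addrC addKr.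
by rewrite e addrC subrK.
Qed.

Lemma unit_val_surj (X Y : C) (f : hom X Y) : {u | unit_val u ≡ f}.
Proof.
have [x ex] := cid (pr_surj (P X Y) f).
have [|u eu] := @pres_hom R unit_ob (hom_ob X Y) x.
  by exists 0; rewrite !of_mxK !mul0mx.
by exists u; rewrite /unit_val eu.
Qed.

Lemma fp_homs_hom_structure : admits_hom_structure C pres_cat.
Proof.
pose nu X Y (f : hom X Y) := sval (unit_val_surj f).
have nuE X Y (f : hom X Y) : unit_val (nu _ _ f) ≡ f := svalP (unit_val_surj f).
split; exists unit_ob hom_bifunctor nu.
- move=> X X' Y Y' f g h; apply: hom_ob_eqv => x.
  rewrite hom_mapE /pres mx_of_add mulmxDr pr_add -!/(pres _) !hom_mapE /=.
  by rewrite !comp_addl.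
- move=> X X' Y Y' f g h; apply: hom_ob_eqv => x.
  rewrite hom_mapE /pres mx_of_add mulmxDr pr_add -!/(pres _) !hom_mapE /=.
  by rewrite comp_addr.
- by move=> X Y f g e; apply/unit_val_eqv; rewrite !nuE.
- by move=> X Y f g /unit_val_eqv; rewrite !nuE.
- by move=> X Y u; exists (unit_val u); apply/unit_val_eqv; rewrite nuE.
- move=> X X' Y Y' f x g; apply/unit_val_eqv; rewrite nuE.
  rewrite /unit_val /pres mx_of_comp -!/(pres _) hom_mapE -/(unit_val _) nuE.
  by [].
Qed.

End HomStructure.

End LinearCategories.

(** * The double Freyd category *)

Theorem mainTheorem1 (R : comPzRingType) (hR : coherent R) :
  let P := freyd_category (additive_closure (ring_category R)) in
  equivalent (freyd_category (op_ab P)) (fp_functors R) /\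
  admits_hom_structure (freyd_category (op_ab P)) P.
Proof.
move=> P; split.
  pose F := freyd_map (op_functor_additive (@pres_functor_additive R)).
  apply: (@weak_equivalence_equivalent _ _ (functor_comp F (fp_cokernel_functor R))).
  apply: weak_equivalence_comp (fp_cokernel_functor_weak_equivalence R).
  apply: freyd_map_weak_equivalence; apply: op_functor_weak_equivalence.
  exact: pres_functor_weak_equivalence.
have P_fp := freyd_fp_homs hR (@free_fp_homs R).
exact: fp_homs_hom_structure (freyd_fp_homs hR (op_fp_homs P_fp)).
Qed.
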